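(* Let $\sigma\in C^1((0,1))$ be a positive function with $\int_0^1\sigma(t)\,dt=1$ such that $t\mapsto t\sigma'(t)/\sigma(t)$ is decreasing on $(0,1)$, and let $$f(z)=\int_0^1\frac{\sigma(t)\,dt}{1-tz},\qquad z\in\Lambda:=\mathbb C\setminus[1,\infty).$$ Then for every $x\in[0,1]$ the function $$z\mapsto\frac{f(z)}{f(xz)}$$ belongs to $\mathcal T$.
   Context: Let $\Lambda:=\mathbb C\setminus[1,\infty)$. $\mathcal T$ denotes the set of all functions $F:\Lambda\to\mathbb C$ of the form $$F(z)=\int_0^1\frac{d\mu(t)}{1-tz},\qquad z\in\Lambda,$$ where $\mu$ is a Borel probability measure on $[0,1]$. ''Decreasing'' is meant in the weak sense (non-increasing). *)

(* Defs.v *)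
From HB Require Import structures.
From mathcomp Require Import all_boot all_order all_algebra.
From mathcomp Require Import complex.
From mathcomp Require Import all_classical all_reals all_analysis.

Set Implicit Arguments.
Unset Strict Implicit.
Unset Printing Implicit Defensive.

Import Order.TTheory GRing.Theory Num.Theory.
Import numFieldNormedType.Exports.

Local Open Scope classical_set_scope.
Local Open Scope complex_scope.
Local Open Scope ring_scope.

Definition slit_plane (R : realType) : set R[i] :=
  ~` [set r%:C | r in `[1, +oo[ ].

(* Taken componentwise; [Rintegral] returns 0 on a part that is not integrable,
   but every integrand used below is integrable when z is in the slit plane. *)
Definition cintegral (d : measure_display) (T : measurableType d)
    (R : realType) (mu : {measure set T -> \bar R}) (D : set T)
    (g : T -> R[i]) : R[i] :=
  (\int[mu]_(t in D) complex.Re (g t)) +i*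
  (\int[mu]_(t in D) complex.Im (g t)).

(* Functions on the slit plane are total functions on R[i] whose values off the
   slit plane are ignored; a Borel probability measure on [0, 1] is one on R
   that gives mass 1 to [0, 1]. *)
Definition classT (R : realType) (F : R[i] -> R[i]) : Prop :=
  exists mu : probability (measurableTypeR R) R,
    mu `[0, 1]%classic = 1%E /\
    forall z, slit_plane z ->
      F z = cintegral mu `[0, 1]%classic (fun t : R => (1 - t%:C * z)^-1).

Definition density_transform (R : realType) (sigma : R -> R) (z : R[i]) :
    R[i] :=
  cintegral (@lebesgue_measure R) `]0, 1[%classic
    (fun t : R => (sigma t)%:C / (1 - t%:C * z)).

(* Main.v *)
Require Import Defs.
From mathcomp Require Import all_boot all_order all_algebra.
From mathcomp Require Import complex polyrcf ring lra zify.
From mathcomp Require Import all_classical all_reals all_analysis.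
From mathcomp Require Import measurable_realfun.

(** Write [x = q ^ k] with [q] close to [1] and discretise the density on the grid
    [q ^ i], so that [f z] is approximated by
    [f_n z = \sum_(i <= n) w i / (1 - q ^ i * z)].  Monotonicity of [t sigma' / sigma]
    makes [w] log-concave.  The reciprocals [eta j] of the zeros of [f_n] lie between
    consecutive grid points, and log-concavity forces [eta j.+1 <= q * eta j].  After
    cancellation, the zeros and poles of [f_n z / f_n (q ^ k * z)] therefore interlace,
    which makes it a convex combination of functions [1 / (1 - p * z)] with [p] in
    [[0, 1]].  A compactness argument for the resulting finitely supported laws gives
    the measure in the limit. *)

Set Implicit Arguments.
Unset Strict Implicit.
Unset Printing Implicit Defensive.

Import Order.TTheory GRing.Theory Num.Theory.
Import numFieldNormedType.Exports.

Local Open Scope classical_set_scope.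
Local Open Scope complex_scope.
Local Open Scope ring_scope.

(** * Interlacing zeros and poles *)

(** The grid is geometric so that the dilation by [q ^ k] maps nodes to nodes: the poles of both
    sums lie on one grid, and the common ones cancel. It remains to compare zeros [eta (k + j)] with
    poles [q ^ k * eta j], which is the one-step inequality iterated [k] times. The hypothesis on
    [sigma] enters because it makes [sigma (q * t) / sigma t] increase with [t]. The limit is taken
    along an ultrafilter fixed before [z], so that one measure serves every [z]. Pointwise limits
    along an ultrafilter need not be measurable, and dominated convergence can fail there; passing
    to monotone quantile functions removes both difficulties. The discrete identity is kept as a
    product, which passes to the limit; the division by [f (x * z)] is made only there, where
    nonvanishing comes from a half plane argument. *)

(** Induction on [m]: since [r m] lies between [p m.+1] and [p j], the new factor
    [(1 - r m * z) / (1 - p m.+1 * z)] turns [1 / (1 - p j * z)] into a convex combination of itself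
    and [1 / (1 - p m.+1 * z)]. No residues are computed, so a zero may coincide with a pole, as
    happens later for [k = 0]. *)
Lemma interlacing_partial_fractions (R : rcfType) (p r : nat -> R) (m : nat) :
  (forall j, (j < m)%N -> r j <= p j) ->
  (forall j, (j < m)%N -> p j.+1 <= r j) ->
  exists c : nat -> R,
    [/\ forall j, 0 <= c j, \sum_(j < m.+1) c j = 1 &
    forall z : R[i], (forall j, (j <= m)%N -> 1 - (p j)%:C * z != 0) ->
    (\prod_(j < m) (1 - (r j)%:C * z)) / (\prod_(j < m.+1) (1 - (p j)%:C * z)) =
    \sum_(j < m.+1) (c j)%:C / (1 - (p j)%:C * z)].
Proof.
elim: m => [|m IH] rp pr.
  exists (fun=> 1); split=> //; first by rewrite big_ord1.
  by move=> y _; rewrite big_ord0 !big_ord1.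
case: IH => [j jm|j jm|c [c0 c1 cE]]; [exact/rp/ltnW|exact/pr/ltnW|].
have p_anti j : (j <= m)%N -> r m <= p j.
  move=> jm; apply: le_trans (rp m _) _ => //.
  elim: m jm rp pr {c1 cE} => [|n IH]; first by rewrite leqn0 => /eqP ->.
  rewrite leq_eqVlt => /orP[/eqP -> //|jn] rp pr.
  apply: le_trans (pr n _) _ => //; apply: le_trans (rp n _) _ => //.
  by apply: IH => // i lt_in; [apply: rp|apply: pr]; rewrite ltnW.
(* If [p j = p m.+1], division by 0 gives the value 0; [alE] still holds, because [r m] then equals
   both. *)
pose al j := (p j - r m) / (p j - p m.+1).
have pS j : (j <= m)%N -> p m.+1 <= p j by move=> jm; apply: le_trans (pr m _) (p_anti _ _).
have al0 j : (j <= m)%N -> 0 <= al j.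
  by move=> jm; rewrite divr_ge0 // subr_ge0 ?p_anti ?pS.
have al1 j : (j <= m)%N -> al j <= 1.
  move=> jm; rewrite /al; have := pS j jm; rewrite le_eqVlt => /orP[/eqP ->|lt].
    by rewrite subrr invr0 mulr0.
  by rewrite ler_pdivrMr ?subr_gt0 // mul1r lerD2l lerN2 pr.
have alE j : (j <= m)%N -> r m = al j * p m.+1 + (1 - al j) * p j.
  move=> jm; rewrite /al; case: (eqVneq (p j) (p m.+1)) => [e|ne].
    have -> : r m = p j by apply/eqP; rewrite eq_le p_anti // e pr.
    by rewrite e subrr mul0r; ring.
  by field; rewrite subr_eq0.
exists (fun j => if (j <= m)%N then c j * al j else if j == m.+1 then
   \sum_(i < m.+1) c i * (1 - al i) else 0); split.
- move=> j; case: ifP => jm; first by rewrite mulr_ge0 ?al0.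
  case: ifP => // _; apply: sumr_ge0 => i _; rewrite mulr_ge0 // subr_ge0 al1 //.
  by rewrite -ltnS.
- rewrite big_ord_recr /= ltnn eqxx -[RHS]c1.
  under eq_bigr => i _ do rewrite -ltnS ltn_ord.
  by rewrite -big_split /=; apply: eq_bigr => i _; rewrite -mulrDr addrC subrK mulr1.
move=> y ynz.
have ynz' j : (j <= m)%N -> 1 - (p j)%:C * y != 0 by move=> jm; rewrite ynz // ltnW.
rewrite big_ord_recr /= [X in _ / X]big_ord_recr /=.
rewrite invfM mulrACA (cE _ ynz').
rewrite [RHS]big_ord_recr /= ltnn eqxx.
under [in RHS]eq_bigr => i _ do rewrite -ltnS ltn_ord.
rewrite mulr_suml rmorph_sum [X in _ = _ + X]mulr_suml -big_split /=; apply: eq_bigr => i _ /=.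
have im : (i <= m)%N by rewrite -ltnS.
have := ynz _ (leqnn m.+1); have := ynz' _ im => n1 n2.
move: (al i) (alE _ im) => a ->.
have -> : (a * p m.+1 + (1 - a) * p i)%:C =
  a%:C * (p m.+1)%:C + (1 - a%:C) * (p i)%:C :> R[i].
  by rewrite rmorphD !rmorphM rmorphB rmorph1.
rewrite (rmorphM _ (c i) a) (rmorphM _ (c i) (1 - a)) rmorphB rmorph1 /=.
by field; rewrite n1 n2.
Qed.

(** The polynomial is the numerator of [\sum_i w i / (X - t i)]. At a node a single summand
    survives, with a sign that alternates from node to node; this gives a root in each gap, and [n]
    distinct roots exhaust the degree. *)
Lemma root_between_nodes (R : rcfType) (n : nat) (w t : nat -> R) :
  (forall i, (i <= n)%N -> 0 < w i) ->
  (forall i j, (i < j)%N -> t j < t i) ->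
  exists eta : nat -> R, (forall j, (j < n)%N -> t j.+1 < eta j < t j) /\
   \sum_(i < n.+1) w i *: \prod_(j < n.+1 | j != i) ('X - (t j)%:P) =
   (\sum_(i < n.+1) w i) *: \prod_(j < n) ('X - (eta j)%:P).
Proof.
move=> w0 tlt; set P := \sum_(i < _) _.
have Pt (k : 'I_n.+1) : P.[t k] = w k * \prod_(j < n.+1 | j != k) (t k - t j).
  rewrite /P horner_sum (bigD1 k) //= [X in _ + X]big1 ?addr0 => [|i ik].
    rewrite hornerZ horner_prod; congr (_ * _).
    by apply: eq_bigr => i _; rewrite hornerXsubC.
  rewrite hornerZ horner_prod (bigD1 k) 1?eq_sym //= hornerXsubC subrr.
  by rewrite mul0r mulr0.
have szi (i : 'I_n.+1) : size (\prod_(j < n.+1 | j != i) ('X - (t j)%:P)) = n.+1.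
  have -> : \prod_(j < n.+1 | j != i) ('X - (t j)%:P) =
     \prod_(j <- enum (predC1 i)) ('X - (t j)%:P) by rewrite big_enum.
  by rewrite size_prod_XsubC -cardE cardC1 card_ord.
have Pn : P`_n = \sum_(i < n.+1) w i.
  rewrite /P coef_sum; apply: eq_bigr => i _; rewrite coefZ.
  have /monicP : \prod_(j < n.+1 | j != i) ('X - (t j)%:P) \is monic.
    by apply: monic_prod => j _; rewrite monicXsubC.
  by rewrite /lead_coef szi /= => ->; rewrite mulr1.
have W0 : 0 < \sum_(i < n.+1) w i.
  rewrite big_ord_recl ltr_wpDr ?w0 //; apply: sumr_ge0 => i _.
  by apply/ltW/w0; rewrite -ltnS ltn_ord.
have szP : size P = n.+1.
  apply/eqP; rewrite eqn_leq; apply/andP; split.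
    apply: (leq_trans (size_sum _ _ _)); apply/bigmax_leqP => i _.
    by rewrite (leq_trans (size_scale_leq _ _)) // szi.
  by rewrite ltnNge; apply/negP => /leq_sizeP/(_ n (leqnn n)); rewrite Pn; move: W0 => /[swap] ->; rewrite ltxx.
have PP k : (k < n)%N -> P.[t k.+1] * P.[t k] < 0.
  move=> kn; pose k0 : 'I_n.+1 := Ordinal (ltnW kn : (k < n.+1)%N).
  pose k1 : 'I_n.+1 := Ordinal (kn : (k.+1 < n.+1)%N).
  have k01 : k0 != k1 by rewrite -val_eqE /= neq_ltn leqnn.
  rewrite (Pt k0) (Pt k1) (bigD1 k0) //= [X in _ * (_ * X)](bigD1 k1) 1?eq_sym //=.
  rewrite [X in _ * (_ * (_ * X))](eq_bigl (fun i => (i != k1) && (i != k0))); last first.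
    by move=> i; rewrite andbC.
  set A := \prod_(_ < _ | _) _; set B := \prod_(_ < _ | _) _.
  (* Any other node lies on the same side of both consecutive nodes, so its two factors have equal
     signs. *)
  have AB : 0 < A * B.
    rewrite -big_split /=; apply: prodr_gt0 => i /andP[i1 i0].
    have [ik|ki] : (i < k)%N \/ (k.+1 < i)%N.
      move: i1 i0; rewrite -!val_eqE /=; lia.
      by rewrite nmulr_lgt0 ?subr_lt0; apply: tlt; lia.
    by rewrite pmulr_lgt0 ?subr_gt0; apply: tlt; lia.
  have -> : w k.+1 * ((t k.+1 - t k) * A) * (w k * ((t k - t k.+1) * B)) =
     - (w k.+1 * w k * (t k - t k.+1) ^+ 2 * (A * B)) by ring.
  move: (A * B) AB => C C0.
  by rewrite oppr_lt0 !mulr_gt0 ?exprn_gt0 ?subr_gt0 ?tlt ?w0 // ltnW.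
have rootP k : exists e, (k < n)%N -> t k.+1 < e < t k /\ root P e.
  case: (ltnP k n) => [kn|]; last by exists 0.
  have [e] := poly_ivtoo (ltW (tlt _ _ (ltnSn k))) (PP _ kn).
  by rewrite in_itv /= => e1 e2; exists e.
have [eta etaP] := choice rootP.
exists eta; split=> [j jn|]; first by case: (etaP j jn).
have eta_lt i j : (i < j)%N -> (j < n)%N -> eta j < eta i.
  move=> ij jn; have [/andP[_ e1] _] := etaP _ jn.
  have [/andP[e2 _] _] := etaP _ (ltn_trans ij jn).
  apply: (lt_le_trans e1); apply: le_trans (ltW e2).
  by move: ij; rewrite leq_eqVlt => /orP[/eqP ->|/tlt /ltW].
have := @all_roots_prod_XsubC _ P [seq eta i | i <- iota 0 n].
rewrite size_map size_iota szP /lead_coef szP Pn big_map /= => -> //.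
- by rewrite -[n in iota 0 n]subn0 -/(index_iota 0 n) big_mkord.
- apply/allP => e; case/mapP => i; rewrite mem_iota add0n => /= lt_in ->.
  by case: (etaP i lt_in).
- rewrite uniq_rootsE map_inj_in_uniq ?iota_uniq // => i j.
  rewrite !mem_iota !add0n /= => lt_in lt_jn eij.
  case: (ltngtP i j) => // ij.
    by have := eta_lt _ _ ij lt_jn; rewrite eij ltxx.
  by have := eta_lt _ _ ij lt_in; rewrite eij ltxx.
Qed.

(** Substitute [X = 1 / y] in the polynomial identity: [1 - a * y = y * (y^-1 - a)], and both sides
    carry the same power of [y]. The point [y = 0] is treated apart. *)
Lemma partial_fraction_sum_factor (R : rcfType) (n : nat) (w t eta : nat -> R)
    (y : R[i]) :
  \sum_(i < n.+1) w i *: \prod_(j < n.+1 | j != i) ('X - (t j)%:P) =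
   (\sum_(i < n.+1) w i) *: \prod_(j < n) ('X - (eta j)%:P) ->
  (forall i, 1 - (t i)%:C * y != 0) ->
  \sum_(i < n.+1) (w i)%:C / (1 - (t i)%:C * y) =
  (\sum_(i < n.+1) w i)%:C * (\prod_(j < n) (1 - (eta j)%:C * y)) /
    \prod_(i < n.+1) (1 - (t i)%:C * y).
Proof.
move=> PE ynz; set W := (\sum_(i < n.+1) w i).
have Dnz : \prod_(i < n.+1) (1 - (t i)%:C * y) != 0.
  by apply/prodf_neq0 => i _; apply: ynz.
apply: (canRL (mulfK Dnz)); rewrite mulr_suml.
have cofactor (i : 'I_n.+1) : (w i)%:C / (1 - (t i)%:C * y) *
    \prod_(j < n.+1) (1 - (t j)%:C * y) =
    (w i)%:C * \prod_(j < n.+1 | j != i) (1 - (t j)%:C * y).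
  by rewrite (bigD1 i) //= mulrA divfK.
under eq_bigr => i _ do rewrite cofactor.
have [->|y0] := eqVneq y 0.
  have one (a : R) : 1 - a%:C * 0 = 1 :> R[i] by rewrite mulr0 subr0.
  rewrite (eq_bigr (fun i : 'I__ => (w i)%:C)) => [|i _]; last first.
    by rewrite big1 ?mulr1 // => j _; rewrite one.
  rewrite [X in _ * X]big1 ?mulr1; last by move=> j _; rewrite mulr0 subr0.
  by rewrite /W rmorph_sum.
have homog (a : R) : 1 - a%:C * y = y * (y^-1 - a%:C) by field.
under eq_bigr => i _ do under eq_bigr => j _ do rewrite homog.
under [in RHS]eq_bigr => j _ do rewrite homog.
under eq_bigr => i _ do rewrite big_split /= prodr_const cardC1 card_ord /= mulrCA.
rewrite big_split /= prodr_const card_ord mulrCA -mulr_sumr; congr (_ * _).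
have /(congr1 (fun q => (map_poly (real_complex R) q).[y^-1])) := PE.
rewrite rmorph_sum horner_sum linearZ /= hornerZ rmorph_prod horner_prod => E.
rewrite (eq_bigr _ (fun j _ => esym (hornerXsubC _ _))).
under eq_bigr => i _ do under eq_bigr => j _ do rewrite -(hornerXsubC (t j)%:C).
under [in RHS]eq_bigr => j _ do rewrite -(map_polyXsubC (real_complex R)).
rewrite -E; apply: eq_bigr => i _.
rewrite linearZ /= hornerZ rmorph_prod horner_prod; congr (_ * _).
by apply: eq_bigr => j _ /=; rewrite map_polyXsubC.
Qed.

(* Let [G s = \sum_i w i / (s - q ^ i)].  Comparing [w i.+1] with [(w j.+1 / w j) * w i]
   term by term, log-concavity turns [G (eta j) = 0] into [G (q * eta j) <= 0]; since [G]
   decreases between poles, the zero [eta j.+1] is not to the right of [q * eta j]. *)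
Lemma root_ratio (R : rcfType) (q : R) (n : nat) (w eta : nat -> R) :
  0 < q < 1 -> (forall i, 0 < w i) ->
  (forall i, w i.+2 * w i <= w i.+1 ^+ 2) ->
  (forall j, (j < n)%N -> q ^+ j.+1 < eta j < q ^+ j) ->
  \sum_(i < n.+1) w i *: \prod_(j < n.+1 | j != i) ('X - (q ^+ j)%:P) =
   (\sum_(i < n.+1) w i) *: \prod_(j < n) ('X - (eta j)%:P) ->
  forall j, (j.+1 < n)%N -> eta j.+1 <= q * eta j.
Proof.
move=> /andP[q0 q1] w0 wlc etaq PE j jn.
have qle i k : (i <= k)%N -> q ^+ k <= q ^+ i.
  by move=> ik; apply: ler_wiXn2l => //; apply: ltW.
have ratio_anti i k : (i <= k)%N -> w k.+1 / w k <= w i.+1 / w i.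
  elim: k => [|k IH]; first by rewrite leqn0 => /eqP ->.
  rewrite leq_eqVlt => /orP[/eqP -> //|/IH]; apply: le_trans.
  by rewrite ler_pdivrMr // mulrAC ler_pdivlMr // -expr2.
pose G s := \sum_(i < n.+1) w i / (s - q ^+ i).
have nonpole s k i : q ^+ k.+1 < s < q ^+ k -> s - q ^+ i != 0.
  move=> /andP[s1 s2]; rewrite subr_eq0; apply/eqP => si.
  case: (leqP i k) => ik; first by have := lt_le_trans s2 (qle _ _ ik); rewrite si ltxx.
  by have := le_lt_trans (qle _ _ ik) s1; rewrite si ltxx.
have Geta k : (k < n)%N -> G (eta k) = 0.
  move=> kn; have nz i := nonpole _ _ i (etaq _ kn).
  have Dnz : \prod_(i < n.+1) (eta k - q ^+ i) != 0.
    by apply/prodf_neq0 => i _; apply: nz.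
  apply: (mulIf Dnz); rewrite mul0r.
  have /(congr1 (fun p => p.[eta k])) := PE.
  rewrite hornerZ horner_prod (bigD1 (Ordinal kn)) //= hornerXsubC subrr mul0r mulr0.
  rewrite horner_sum => PE0; rewrite -[RHS]PE0 mulr_suml; apply: eq_bigr => i _.
  rewrite hornerZ horner_prod (bigD1 i) //= mulrA divfK //; congr (_ * _).
  by apply: eq_bigr => l _; rewrite hornerXsubC.
rewrite leNgt; apply/negP => lt_eta.
have /andP[e1 e2] := etaq _ (ltnW jn); have /andP[e3 e4] := etaq _ jn.
have e0 : 0 < eta j by apply: lt_trans e1; rewrite exprn_gt0.
have qe : q ^+ j.+2 < q * eta j < q ^+ j.+1.
  by rewrite ![q ^+ _.+1]exprS !ltr_pM2l // -exprS e1 e2.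
have gap i : 0 < w i / (q * eta j - q ^+ i) - w i / (eta j.+1 - q ^+ i).
  have [n1 n2] := (nonpole _ _ i qe, nonpole _ _ i (etaq _ jn)).
  have -> : w i / (q * eta j - q ^+ i) - w i / (eta j.+1 - q ^+ i) =
     w i * (eta j.+1 - q * eta j) / ((q * eta j - q ^+ i) * (eta j.+1 - q ^+ i)).
    by field; rewrite n1 n2.
  apply: divr_gt0; first by rewrite mulr_gt0 ?subr_gt0.
  case/andP: qe => qe1 qe2.
  case: (leqP i j.+1) => ij.
    by rewrite nmulr_lgt0 subr_lt0 (lt_le_trans _ (qle _ _ ij)).
  by rewrite pmulr_lgt0 subr_gt0 (le_lt_trans (qle _ _ ij)).
have : G (eta j.+1) < G (q * eta j).
  rewrite /G -subr_gt0 -sumrB big_ord_recl ltr_wpDr //.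
  by apply: sumr_ge0 => i _; apply/ltW/gap.
rewrite Geta //; apply/negP; rewrite -leNgt.
(* The term of the node 1 is negative at [q * eta j] and is dropped. The other nodes are [q] times
   their predecessors, which brings the argument back to [eta j]. *)
rewrite /G big_ord_recl expr0.
have qeta1 : q * eta j < 1.
  by case/andP: qe => _ /lt_le_trans; apply; rewrite -[1](expr0 q) qle.
have -> : \sum_(i < n) w (lift ord0 i) / (q * eta j - q ^+ (lift ord0 i)) =
   q^-1 * \sum_(i < n) w i.+1 / (eta j - q ^+ i).
  rewrite mulr_sumr; apply: eq_bigr => i _; rewrite lift0 exprS -mulrBr invfM.
  by rewrite mulrCA.
rewrite -[leRHS]addr0 lerD //.
  by rewrite pmulr_rle0 // invr_le0 subr_le0 ltW.
rewrite pmulr_rle0 ?invr_gt0 //.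
(* For [i <= j] the ratio [w i.+1 / w i] is at least the one at [j] and the denominator is negative;
   for [i > j] both signs are reversed. *)
apply: (@le_trans _ _ (w j.+1 / w j * \sum_(i < n) w i / (eta j - q ^+ i))).
  rewrite mulr_sumr; apply: ler_sum => i _; rewrite mulrA.
  case: (leqP i j) => ij.
    rewrite ler_wnM2r //; last by rewrite -ler_pdivlMr // ratio_anti.
    by rewrite invr_le0 subr_le0 ltW // (lt_le_trans e2) // qle.
  rewrite ler_wpM2r //; last by rewrite -ler_pdivrMr // ratio_anti // ltnW.
  by rewrite invr_ge0 subr_ge0 ltW // (le_lt_trans _ e1) // qle.
(* The sum stops before index [n]; by [Geta] it is the opposite of the omitted term, which is
   positive at [eta j]. *)
have := Geta _ (ltnW jn); rewrite /G big_ord_recr /= => /eqP.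
rewrite addr_eq0 => /eqP ->; rewrite mulrN oppr_le0 mulr_ge0 // ltW // divr_gt0 //.
by rewrite subr_gt0 (le_lt_trans _ e1) // qle // ltnW.
Qed.

Lemma geometric_transform_quotient (R : rcfType) (q : R) (n k : nat) (w : nat -> R) :
  0 < q < 1 -> (forall i, 0 < w i) ->
  (forall i, w i.+2 * w i <= w i.+1 ^+ 2) ->
  exists (m : nat) (c p : nat -> R),
    [/\ forall j, 0 <= c j, \sum_(j < m.+1) c j = 1,
      forall j, (j <= m)%N -> 0 <= p j <= 1,
      forall i j, (i <= j <= m)%N -> p j <= p i &
    forall z : R[i], (forall t : R, 0 <= t <= 1 -> 1 - t%:C * z != 0) ->
    \sum_(i < n.+1) (w i)%:C / (1 - (q ^+ i)%:C * z) =
    (\sum_(i < n.+1) (w i)%:C / (1 - (q ^+ i)%:C * ((q ^+ k)%:C * z))) *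
      \sum_(j < m.+1) (c j)%:C / (1 - (p j)%:C * z)].
Proof.
move=> q01 w0 wlc; have /andP[q0 q1] := q01.
have qlt i j : (i < j)%N -> q ^+ j < q ^+ i by move=> ij; rewrite ltr_iXn2l.
have qle i j : (i <= j)%N -> q ^+ j <= q ^+ i.
  by move=> ij; apply: ler_wiXn2l => //; apply: ltW.
have [eta0 [eta0q PE0]] := root_between_nodes (n := n) (fun i _ => w0 i) qlt.
have eta0S := root_ratio q01 w0 wlc eta0q PE0.
(* The sequence continues with [q ^ n.+1], [q ^ n.+2], ...: up to index [k + n] these are the
   uncancelled poles of the dilated sum, together with, if [k > n + 1], nodes that also occur among
   the [p j]. The continuation preserves the one-step inequality. *)
pose eta j := if (j < n)%N then eta0 j else q ^+ j.+1.
have etaq j : q ^+ j.+1 <= eta j <= q ^+ j.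
  rewrite /eta; case: ifP => jn; last by rewrite lexx qle.
  by have /andP[/ltW -> /ltW ->] := eta0q _ jn.
have etaS j : eta j.+1 <= q * eta j.
  have [jn|nj] := ltnP j.+1 n; first by rewrite /eta jn (ltnW jn) eta0S.
  rewrite {1}/eta ltnNge nj /= exprS ler_pM2l //.
  by have /andP[] := etaq j.
have etak j : eta (k + j)%N <= q ^+ k * eta j.
  elim: k => [|l IH]; first by rewrite mul1r.
  by rewrite addSn (le_trans (etaS _)) // exprS -mulrA ler_pM2l.
have PE : \sum_(i < n.+1) w i *: \prod_(j < n.+1 | j != i) ('X - (q ^+ j)%:P) =
   (\sum_(i < n.+1) w i) *: \prod_(j < n) ('X - (eta j)%:P).
  by rewrite PE0; congr (_ *: _); apply: eq_bigr => j _; rewrite /eta ltn_ord.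
(* The final 0 gives a factor 1: the quotient has as many zeros as poles, and its value at infinity
   becomes an atom at 0. *)
pose p j := if (j < k)%N then q ^+ j else
  if (j < k + n)%N then q ^+ k * eta (j - k)%N else 0.
have q01n i : 0 <= q ^+ i <= 1.
  by rewrite exprn_ge0 ?(ltW q0) //= -[leRHS](expr0 q) qle.
have eta01 i : 0 <= eta i <= 1.
  have /andP[a b] := etaq i; have /andP[_ /(le_trans b) ->] := q01n i.
  by rewrite (le_trans _ a) // exprn_ge0 // ltW.
have p01 j : 0 <= p j <= 1.
  rewrite /p; case: ifP => // _; case: ifP => _; last by rewrite lexx ler01.
  have /andP[a b] := q01n k; have /andP[e d] := eta01 (j - k)%N.
  by rewrite mulr_ge0 //= mulr_ile1.
have rp j : (j < k + n)%N -> eta j <= p j.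
  move=> jkn; rewrite /p jkn; case: ifP => jk; first by case/andP: (etaq j).
  by rewrite -{1}(@subnKC k j) ?etak // leqNgt jk.
have pr j : (j < k + n)%N -> p j.+1 <= eta j.
  move=> jkn; have /andP[a b] := etaq j; apply: le_trans a; rewrite /p.
  case: ifP => jk //; case: ifP => // _; last by rewrite exprn_ge0 // ltW.
  have kj : (k <= j.+1)%N by rewrite leqNgt jk.
  rewrite -{2}(subnKC kj) exprD ler_pM2l ?exprn_gt0 //.
  by case/andP: (etaq (j.+1 - k)%N).
have [c [c0 c1 cE]] := interlacing_partial_fractions rp pr.
exists (k + n)%N, c, p; split=> // [i j /andP[]|z znz].
  elim: j => [|j IH]; first by rewrite leqn0 => /eqP ->.
  rewrite leq_eqVlt => /orP[/eqP -> //|ij] jkn.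
  by rewrite (le_trans (pr _ jkn)) // (le_trans (rp _ jkn)) // IH // ltnW.
rewrite -cE => [|j _]; last exact: znz.
have qzE i : (q ^+ i)%:C * ((q ^+ k)%:C * z) = (q ^+ (k + i))%:C * z.
  by rewrite mulrA -rmorphM /= -exprD addnC.
rewrite (partial_fraction_sum_factor PE); last by move=> i; apply: znz.
rewrite (partial_fraction_sum_factor PE); last by move=> i; rewrite qzE znz.
set W := (\sum_(i < _) _)%:C; set A := \prod_(j < n) (1 - _).
rewrite [X in _ = _ / X * _](eq_bigr (fun i : 'I__ => 1 - (q ^+ (k + i))%:C * z)); last first.
  by move=> i _; rewrite qzE.
set B := \prod_(j < n) (1 - _ * (_ * z)).
have BE : B = \prod_(j < n) (1 - (q ^+ k * eta j)%:C * z).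
  by apply: eq_bigr => j _; rewrite mulrA -rmorphM /= [eta j * _]mulrC.
have Bnz : B != 0.
  rewrite BE; apply/prodf_neq0 => i _; apply: znz.
  have /andP[a b] := q01n k; have /andP[e d] := eta01 i.
  by rewrite mulr_ge0 //= mulr_ile1.
(* [Q 0 n.+1 * Q n.+1 (k + n.+1)] and [Q 0 k * Q k (k + n.+1)] are the same full product, which
   spares a distinction between [k <= n] and [k > n]. *)
pose Q a b := \prod_(a <= i < b) (1 - (q ^+ i)%:C * z).
have Qnz a b : Q a b != 0.
  rewrite prodf_seq_neq0; apply/allP => i _; exact: znz.
have Qcat a b d : (a <= b)%N -> (b <= d)%N -> Q a b * Q b d = Q a d.
  by move=> ab bd; rewrite /Q [RHS](@big_cat_nat _ _ _ b).
have -> : \prod_(i < n.+1) (1 - (q ^+ i)%:C * z) = Q 0 n.+1 by rewrite /Q big_mkord.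
have -> : \prod_(i < n.+1) (1 - (q ^+ (k + i))%:C * z) = Q k (k + n.+1)%N.
  rewrite -[X in Q X _]add0n /Q big_addn addKn big_mkord.
  by apply: eq_bigr => i _; rewrite addnC.
have -> : \prod_(j < k + n) (1 - (eta j)%:C * z) = A * Q n.+1 (k + n.+1)%N.
  rewrite -(big_mkord xpredT (fun j => 1 - (eta j)%:C * z)).
  rewrite (@big_cat_nat _ _ _ n) ?leq_addl //= big_mkord; congr (_ * _).
  rewrite /Q addnS big_add1 /=; apply: eq_big_nat => i /andP[ni _].
  by rewrite /eta ltnNge ni.
have -> : \prod_(j < (k + n).+1) (1 - (p j)%:C * z) = Q 0 k * B.
  rewrite big_ord_recr /= {2}/p ltnn ltnNge leq_addr /= mul0r subr0 mulr1.
  rewrite -(big_mkord xpredT (fun j => 1 - (p j)%:C * z)).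
  rewrite (@big_cat_nat _ _ _ k) ?leq_addr //=; congr (_ * _).
    by apply: eq_big_nat => i /andP[_ ik]; rewrite /p ik.
  rewrite -[X in bigop.body _ (index_iota X _)]add0n big_addn addKn big_mkord BE.
  apply: eq_bigr => i _.
  by rewrite /p ltnNge leq_addl /= [(k + n)%N]addnC ltn_add2r ltn_ord addnK.
have E1 := Qcat 0 k (k + n.+1)%N (leq0n _) (leq_addr _ _).
have E2 := Qcat 0 n.+1 (k + n.+1)%N (leq0n _) (leq_addl _ _).
have E3 : Q 0 n.+1 = Q 0 k * Q k (k + n.+1)%N / Q n.+1 (k + n.+1)%N.
  by rewrite E1 -E2 mulfK.
rewrite E3; field.
by rewrite Bnz !Qnz.
Qed.

(** * The kernel [1 / (1 - t * z)] on the slit plane *)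

Lemma Re_le_normc (R : rcfType) (z : R[i]) : `|complex.Re z| <= Normc.normc z.
Proof. by case: z => a b /=; rewrite -sqrtr_sqr ler_wsqrtr // lerDl sqr_ge0. Qed.

Lemma Im_le_normc (R : rcfType) (z : R[i]) : `|complex.Im z| <= Normc.normc z.
Proof. by case: z => a b /=; rewrite -sqrtr_sqr ler_wsqrtr // lerDr sqr_ge0. Qed.

Lemma slit_half_plane (R : rcfType) (a b : R) : (b = 0 -> a < 1) ->
  exists beta c : R, 0 < c /\
    forall t, 0 <= t <= 1 -> c <= 1 - t * a + beta * (t * b).
Proof.
move=> ab; have [b0|b0] := eqVneq b 0.
  exists 0, (Num.min 1 (1 - a)); split.
    by rewrite lt_min ltr01 subr_gt0 ab.
  move=> t /andP[t0 t1]; rewrite mul0r addr0 ge_min.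
  have [a0|a0] := leP 0 a; apply/orP; [right|left]; nra.
(* This slope makes [beta * (t * b)] equal to [t * (|a| + 1)], which outweighs [t * a]. *)
exists ((`|a| + 1) / b), 1; split=> // t /andP[t0 t1].
have -> : (`|a| + 1) / b * (t * b) = t * (`|a| + 1) by field.
have := ler_norm a; nra.
Qed.

(* The segment from [1] to [1 - z] avoids [0], so it lies in an open half plane whose
   boundary passes through [0]; [beta] is the slope of that half plane. *)
Lemma kernel_bounds (R : rcfType) (z : R[i]) :
  (complex.Im z = 0 -> complex.Re z < 1) ->
  exists L beta c : R, [/\ 0 <= L, 0 < c,
    forall t, 0 <= t <= 1 -> 1 - t%:C * z != 0,
    forall t, 0 <= t <= 1 ->
      c <= complex.Re (1 - t%:C * z)^-1 + beta * complex.Im (1 - t%:C * z)^-1 &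
    [/\ forall t, 0 <= t <= 1 -> `|complex.Re (1 - t%:C * z)^-1| <= L,
        forall t, 0 <= t <= 1 -> `|complex.Im (1 - t%:C * z)^-1| <= L,
        forall s t, 0 <= s <= 1 -> 0 <= t <= 1 ->
        `|complex.Re (1 - s%:C * z)^-1 - complex.Re (1 - t%:C * z)^-1| <= L * `|s - t| &
        forall s t, 0 <= s <= 1 -> 0 <= t <= 1 ->
        `|complex.Im (1 - s%:C * z)^-1 - complex.Im (1 - t%:C * z)^-1| <= L * `|s - t| ]].
Proof.
case: z => a b ab.
have [beta [c [c0 cN]]] := slit_half_plane ab.
pose D t := (1 - t * a) ^+ 2 + (t * b) ^+ 2.
have kE t : (1 - t%:C * (a +i* b))^-1 = ((1 - t * a) / D t) +i* ((t * b) / D t).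
  rewrite /D; simpc; rewrite /GRing.inv /= sqrrN; congr (_ +i* _).
  by rewrite mulNr opprK.
have normE t : Normc.normc (1 - t%:C * (a +i* b)) = Num.sqrt (D t).
  by rewrite /D; simpc; rewrite /= sqrrN.
(* The squared distance from 0 to the line [u + beta * v = c]; by Cauchy-Schwarz it bounds [D] from
   below. *)
pose dl := c ^+ 2 / (1 + beta ^+ 2).
have b1 : 0 < 1 + beta ^+ 2 by rewrite ltr_wpDr ?sqr_ge0.
have dl0 : 0 < dl by rewrite divr_gt0 ?exprn_gt0.
have Ddl t : 0 <= t <= 1 -> dl <= D t.
  move=> t01; rewrite /dl ler_pdivrMr // /D.
  have := cN t t01; set u := 1 - t * a; set v := t * b => cuv.
  have : c ^+ 2 <= (u + beta * v) ^+ 2 by rewrite lerXn2r ?nnegrE // ?(ltW c0) // (le_trans (ltW c0)).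
  have := sqr_ge0 (beta * u - v); lra.
pose M := (1 + `|a|) ^+ 2 + b ^+ 2.
have DM t : 0 <= t <= 1 -> D t <= M.
  move=> /andP[t0 t1]; rewrite /D /M lerD //.
    rewrite -[leLHS]real_normK ?num_real // lerXn2r ?nnegrE ?addr_ge0 //.
    rewrite (le_trans (ler_normB _ _)) // normr1 lerD2l normrM (ger0_norm t0).
    by rewrite ler_piMl.
  by rewrite exprMn ler_piMl ?sqr_ge0 // exprn_ile1.
pose s := Num.sqrt dl; have s0 : 0 < s by rewrite sqrtr_gt0.
have knorm t : 0 <= t <= 1 -> Normc.normc (1 - t%:C * (a +i* b))^-1 <= s^-1.
  move=> t01; rewrite Normc.normcV normE lef_pV2 ?posrE ?sqrtr_gt0 //.
    by rewrite ler_wsqrtr // Ddl.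
  by rewrite (lt_le_trans dl0) // Ddl.
have knz t : 0 <= t <= 1 -> 1 - t%:C * (a +i* b) != 0.
  move=> t01; apply/eqP => e; have := normE t; rewrite e Normc.normc0.
  move/esym/eqP; rewrite sqrtr_eq0 leNgt; apply/negP; rewrite negbK.
  by rewrite (lt_le_trans dl0) // Ddl.
pose L := s^-1 + Normc.normc (a +i* b) * (s^-1 * s^-1).
have n0 : 0 <= Normc.normc (a +i* b) by apply: sqrtr_ge0.
have sV0 : 0 <= s^-1 by rewrite invr_ge0 ltW.
have Lge : s^-1 <= L by rewrite /L lerDl !mulr_ge0.
have kdiff t t' : 0 <= t <= 1 -> 0 <= t' <= 1 ->
   Normc.normc ((1 - t%:C * (a +i* b))^-1 - (1 - t'%:C * (a +i* b))^-1) <=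
   L * `|t - t'|.
  move=> t01 t'01.
  have -> : (1 - t%:C * (a +i* b))^-1 - (1 - t'%:C * (a +i* b))^-1 =
    (t - t')%:C * ((a +i* b) * ((1 - t%:C * (a +i* b))^-1 * (1 - t'%:C * (a +i* b))^-1)).
    by rewrite rmorphB /=; field; rewrite !knz.
  rewrite !Normc.normcM mulrC.
  have -> : Normc.normc (t - t')%:C = `|t - t'|.
    by rewrite /= expr0n addr0 sqrtr_sqr.
  rewrite ler_wpM2r // /L -[leLHS]add0r lerD // ler_wpM2l // ler_pM ?knorm //;
    by apply: sqrtr_ge0.
exists L, beta, (c / M); split=> //.
- by rewrite (le_trans sV0).
- by rewrite divr_gt0 // ltr_wpDr ?sqr_ge0 // exprn_gt0 // ltr_wpDr.
- move=> t t01; rewrite kE /= mulrA -mulrDl.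
  have D0 : 0 < D t by rewrite (lt_le_trans dl0) // Ddl.
  have M0 : 0 < M by rewrite (lt_le_trans D0) // DM.
  apply: ler_pM; rewrite ?cN ?invr_ge0 ?(ltW c0) ?(ltW M0) //.
  by rewrite lef_pV2 ?posrE ?DM.
split=> [t t01|t t01|t t' t01 t'01|t t' t01 t'01].
- exact: le_trans (le_trans (Re_le_normc _) (knorm _ t01)) Lge.
- exact: le_trans (le_trans (Im_le_normc _) (knorm _ t01)) Lge.
- by apply: le_trans (kdiff _ _ t01 t'01); rewrite -raddfB; exact: Re_le_normc.
- by apply: le_trans (kdiff _ _ t01 t'01); rewrite -raddfB; exact: Im_le_normc.
Qed.

(** * Integrals over partitions *)

Lemma Rintegral_partition (R : realType) (a : nat -> R) (f : R -> R) (m : nat) :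
  (forall j, (j < m)%N -> a j <= a j.+1) ->
  (@lebesgue_measure R).-integrable `[a 0%N, a m[ (EFin \o f) ->
  \int[@lebesgue_measure R]_(u in `[a 0%N, a m[) f u =
  \sum_(j < m) \int[@lebesgue_measure R]_(u in `[a j, a j.+1[) f u.
Proof.
elim: m => [|m IH] am fi.
  by rewrite big_ord0 set_itvxx Rintegral_set0.
have a0m : a 0%N <= a m.
  elim: m am {IH fi} => // m IH am; apply: le_trans (am _ _) => //.
  by apply: IH => j jm; rewrite am // ltnW.
have amm := am m (ltnSn m).
have E : `[a 0%N, a m.+1[%classic = `[a 0%N, a m[ `|` `[a m, a m.+1[.
  by apply: itv_bndbnd_setU; rewrite bnd_simp.
rewrite E Rintegral_setU //=; last 2 first.
- by rewrite -E.
- rewrite disj_set2E; apply/eqP; rewrite -subset0 => u [] /=.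
  by rewrite !in_itv /= => /andP[_ u1] /andP[u2 _]; have := lt_le_trans u1 u2; rewrite ltxx.
rewrite big_ord_recr /= IH // => [j jm|]; first by rewrite am // ltnW.
by apply: integrableS fi => //; rewrite E; exact: subsetUl.
Qed.

(** Only [h] is replaced by a step function; the density stays under the integral, so each error is
    weighted by the mass of its cell and no bound on [s] is involved. *)
Lemma step_estimate (R : realType) (a : nat -> R) (h s : R -> R) (y e : nat -> R)
    (m : nat) :
  let mu := @lebesgue_measure R in
  (forall j, (j < m)%N -> a j <= a j.+1) ->
  mu.-integrable `[a 0%N, a m[ (EFin \o s) ->
  mu.-integrable `[a 0%N, a m[ (EFin \o (fun u => h u * s u)) ->
  (forall u, a 0%N <= u < a m -> 0 <= s u) ->
  (forall j u, (j < m)%N -> a j <= u < a j.+1 -> `|h u - y j| <= e j) ->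
  `|\int[mu]_(u in `[a 0%N, a m[) (h u * s u) -
     \sum_(j < m) y j * \int[mu]_(u in `[a j, a j.+1[) s u| <=
  \sum_(j < m) e j * \int[mu]_(u in `[a j, a j.+1[) s u.
Proof.
move=> mu am si hsi s0 he.
have mono i k : (i <= k)%N -> (k <= m)%N -> a i <= a k.
  elim: k => [|k IH]; first by rewrite leqn0 => /eqP ->.
  rewrite leq_eqVlt => /orP[/eqP -> //|ik] km.
  by apply: le_trans (am _ km); apply: IH => //; exact: ltnW.
rewrite Rintegral_partition // -sumrB; apply: le_trans (ler_norm_sum _ _ _) _.
apply: ler_sum => j _; have jm := ltn_ord j.
have sub : `[a j, a j.+1[ `<=` `[a 0%N, a m[.
  apply: subset_itv; rewrite bnd_simp; apply: mono => //; exact: ltnW.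
have si' : mu.-integrable `[a j, a j.+1[ (EFin \o s) by apply: integrableS si.
have hsi' : mu.-integrable `[a j, a j.+1[ (EFin \o (fun u => h u * s u)).
  by apply: integrableS hsi.
have ysi k : mu.-integrable `[a j, a j.+1[ (EFin \o (fun u => k * s u)).
  exact: integrableZl si'.
rewrite -!RintegralZl // -RintegralB //.
have di : mu.-integrable `[a j, a j.+1[ (EFin \o (fun u => h u * s u - y j * s u)).
  exact: (integrableB _ hsi' (ysi _)).
apply: le_trans (le_normr_Rintegral _ di) _ => //.
apply: le_Rintegral => //; first exact: integrable_norm.
move=> u uj; have u0 := s0 u (sub _ uj).
by rewrite -mulrBl normrM (ger0_norm u0) ler_wpM2r // he.
Qed.

Lemma Rintegral_itv_cst (R : realType) (a b k : R) : a <= b ->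
  \int[@lebesgue_measure R]_(u in `[a, b[) k = k * (b - a).
Proof.
move=> ab; rewrite Rintegral_cst //= lebesgue_measure_itv /= lte_fin.
case: ifP => // /negbT; rewrite -leNgt => ba.
by have -> : b = a; [apply/eqP; rewrite eq_le ab ba|rewrite subrr].
Qed.

Lemma continuous_of_lipschitz (R : realType) (g : R -> R) (L : R) :
  (forall s t, `|g s - g t| <= L * `|s - t|) -> continuous g.
Proof.
move=> gL t; apply/cvgrPdist_lt => e e0.
have L1 : 0 < `|L| + 1 by rewrite ltr_wpDl.
near=> s; apply: (le_lt_trans (gL _ _)).
apply: (@le_lt_trans _ _ ((`|L| + 1) * `|t - s|)).
  by rewrite ler_wpM2r // (le_trans (ler_norm L)) // lerDl.
rewrite mulrC -ltr_pdivlMr //; near: s.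
by apply: cvgr_dist_lt => //; rewrite divr_gt0.
Unshelve. all: by end_near. Qed.

Lemma lipschitz_comp_measurable (R : realType) (g X : R -> R) (L : R) :
  (forall s t, `|g s - g t| <= L * `|s - t|) ->
  {homo X : u v / u <= v >-> v <= u} ->
  measurable_fun setT (g \o X).
Proof.
move=> gL Xni; apply: measurableT_comp; first exact: continuous_measurable_fun (continuous_of_lipschitz gL).
exact: nonincreasing_measurable.
Qed.

Lemma lipschitz_bounded (R : realType) (g : R -> R) (L t : R) :
  (forall s t, `|g s - g t| <= L * `|s - t|) -> 0 <= t <= 1 ->
  `|g t| <= `|g 0| + `|L|.
Proof.
move=> gL /andP[t0 t1]; have -> : g t = g 0 + (g t - g 0) by rewrite addrC subrK.
rewrite (le_trans (ler_normD _ _)) // lerD2l (le_trans (gL _ _)) // subr0.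
by rewrite (ger0_norm t0) (le_trans (ler_norm _)) // normrM ler_piMr // ger0_norm.
Qed.

Lemma lipschitz_comp_integrable (R : realType) (g X : R -> R) (L : R)
    (b : bool) :
  (forall s t, `|g s - g t| <= L * `|s - t|) ->
  {homo X : u v / u <= v >-> v <= u} -> (forall u, 0 <= X u <= 1) ->
  (@lebesgue_measure R).-integrable [set` Interval (BLeft 0) (BSide b 1)]
     (EFin \o (g \o X)).
Proof.
move=> gL Xni X01; apply: measurable_bounded_integrable => //=.
- by rewrite lebesgue_measure_itv /= lte_fin ltr01 -EFinB ltry.
- by apply: measurable_funTS; exact: lipschitz_comp_measurable gL Xni.
exists (`|g 0| + `|L|); split; first by rewrite num_real.
move=> K gK u _ /=; apply: le_trans (ltW gK); exact: lipschitz_bounded gL _.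
Qed.

Lemma step_estimate_lebesgue (R : realType) (a : nat -> R) (h : R -> R)
    (y e : nat -> R) (m : nat) :
  let mu := @lebesgue_measure R in
  (forall j, (j < m)%N -> a j <= a j.+1) ->
  mu.-integrable `[a 0%N, a m[ (EFin \o h) ->
  (forall j u, (j < m)%N -> a j <= u < a j.+1 -> `|h u - y j| <= e j) ->
  `|\int[mu]_(u in `[a 0%N, a m[) h u - \sum_(j < m) y j * (a j.+1 - a j)| <=
  \sum_(j < m) e j * (a j.+1 - a j).
Proof.
move=> mu am hi he.
have h1 : (fun u => h u * 1) = h by apply/funext => u; rewrite mulr1.
have := @step_estimate R a h (fun=> 1) y e m am.
rewrite h1 => /(_ _ hi _ he).
have E z : \sum_(j < m) z j * \int[mu]_(u in `[a j, a j.+1[) 1 =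
    \sum_(j < m) z j * (a j.+1 - a j).
  by apply: eq_bigr => j _; rewrite Rintegral_itv_cst ?mul1r // am.
rewrite !E; apply=> //; apply: measurable_bounded_integrable => //=.
  by rewrite lebesgue_measure_itv /=; case: ifP => _ //; rewrite -EFinB ltry.
by exists 1; split=> // K K1 u _ /=; rewrite normr1 ltW.
Qed.

(** [X] is the quantile function, in decreasing order, of the law with mass [c j] at [p j]. It
    replaces a law by a monotone function, for which pointwise limits are available. *)
Lemma step_quantile (R : realType) (m : nat) (c p : nat -> R) :
  (forall j, 0 <= c j) -> \sum_(j < m.+1) c j = 1 ->
  (forall j, (j <= m)%N -> 0 <= p j <= 1) ->
  (forall i j, (i <= j <= m)%N -> p j <= p i) ->
  exists X : R -> R, [/\ {homo X : u v / u <= v >-> v <= u},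
    forall u, 0 <= X u <= 1 &
    forall (g : R -> R) L, (forall s t, `|g s - g t| <= L * `|s - t|) ->
      \int[@lebesgue_measure R]_(u in `[0, 1[) g (X u) =
      \sum_(j < m.+1) c j * g (p j)].
Proof.
move=> c0 c1 p01 pni.
pose C j := \sum_(i < j) c i.
have CS j : C j.+1 = C j + c j by rewrite /C big_ord_recr.
have Cnd i j : (i <= j)%N -> C i <= C j.
  elim: j => [|j IH]; first by rewrite leqn0 => /eqP ->.
  rewrite leq_eqVlt => /orP[/eqP -> //|ij].
  by rewrite CS (le_trans (IH ij)) // lerDl.
(* Only [C 1], ..., [C m] are counted, so that [k u <= m] for every real [u], even beyond 1. *)
pose k u := (\sum_(i < m) (C i.+1 <= u)%R)%N.
have km u : (k u <= m)%N.
  rewrite -[leqRHS]card_ord -sum1_card; apply: leq_sum => i _.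
  by case: (_ <= _).
have kC j u : (j <= m)%N -> C j <= u < C j.+1 -> k u = j.
  move=> jm /andP[u1 u2]; rewrite /k -(big_mkord xpredT (fun i => nat_of_bool (C i.+1 <= u))).
  rewrite (@big_cat_nat _ _ _ j) //= [X in (_ + X)%N]big_nat_cond.
  rewrite [X in (_ + X)%N]big1 ?addn0; last first.
    move=> i /andP[/andP[ji _] _]; rewrite leNgt (lt_le_trans u2) //.
    exact: Cnd.
  under eq_big_nat => i /andP[_ ij].
    rewrite (le_trans _ u1) ?Cnd //; over.
  by rewrite sum_nat_const_nat subn0 muln1.
exists (fun u => p (k u)); split.
- move=> u v uv; apply: pni; rewrite km andbT; apply: leq_sum => i _.
  by case: (leP (C i.+1) u) => // Cu; rewrite (le_trans Cu uv).
- by move=> u; exact: p01.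
move=> g L gL.
have kni : {homo (fun u => p (k u)) : u v / u <= v >-> v <= u}.
  move=> u v uv; apply: pni; rewrite km andbT; apply: leq_sum => i _.
  by case: (leP (C i.+1) u) => // Cu; rewrite (le_trans Cu uv).
have C0 : C 0%N = 0 by rewrite /C big_ord0.
have Cm : C m.+1 = 1 by [].
have gi := lipschitz_comp_integrable (X := fun u => p (k u)) true gL kni (fun u => p01 _ (km u)).
have := @step_estimate_lebesgue R C (g \o (fun u => p (k u))) (fun j => g (p j))
  (fun=> 0) m.+1 (fun j _ => Cnd _ _ (leqnSn j)).
rewrite C0 Cm [X in _ <= X]big1 => [|i _]; last by rewrite mul0r.
move=> /(_ gi) H; have /H : forall j u, (j < m.+1)%N -> C j <= u < C j.+1 ->
   `|(g \o (fun u => p (k u))) u - g (p j)| <= 0.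
  by move=> j u jm uj /=; rewrite (kC j) // subrr normr0.
rewrite normr_le0 subr_eq0 => /eqP /= ->; apply: eq_bigr => j _.
by rewrite CS addrAC subrr add0r mulrC.
Qed.

(** On each cell [g \o X] varies by at most [L] times the drop of [X], and the drops telescope to at
    most 1. The bound is uniform in [X], which lets convergence at finitely many points control the
    integrals. *)
Lemma monotone_riemann_sum (R : realType) (g X : R -> R) (L : R) (M : nat) :
  (forall s t, `|g s - g t| <= L * `|s - t|) -> (0 < M)%N ->
  {homo X : u v / u <= v >-> v <= u} -> (forall u, 0 <= X u <= 1) ->
  `|\int[@lebesgue_measure R]_(u in `[0, 1[) g (X u) -
    \sum_(j < M) g (X (j%:R / M%:R)) / M%:R| <= L / M%:R.
Proof.
move=> gL M0 Xni X01; have MR : (0 : R) < M%:R by rewrite ltr0n.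
pose a j : R := j%:R / M%:R.
have aS j : a j.+1 - a j = M%:R^-1 by rewrite /a -mulrBl -natrB // subSnn mul1r.
have L0 : 0 <= L by have := gL 1 0; rewrite subr0 normr1 mulr1; apply: le_trans.
have a0 : a 0%N = 0 by rewrite /a mul0r.
have aM : a M = 1 by rewrite /a divff // gt_eqF.
have gi := lipschitz_comp_integrable true gL Xni X01.
have := @step_estimate_lebesgue R a (g \o X) (fun j => g (X (a j)))
  (fun j => L * (X (a j) - X (a j.+1))) M.
rewrite a0 aM.
have E z : \sum_(j < M) z j * (a j.+1 - a j) = \sum_(j < M) z j * M%:R^-1.
  by apply: eq_bigr => j _; rewrite aS.
rewrite !E => H; apply: le_trans (H _ gi _) _.
- by move=> j _; rewrite -subr_ge0 aS invr_ge0 ltW.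
- move=> j u _ /andP[u1 u2] /=; apply: (le_trans (gL _ _)).
  rewrite ler_wpM2l // ler0_norm ?subr_le0 ?Xni // opprB lerD2l lerN2 Xni //.
  exact: ltW.
rewrite -mulr_suml -mulr_sumr ler_pM2r ?invr_gt0 // -[leRHS]mulr1 ler_wpM2l //.
rewrite -(big_mkord xpredT (fun j => X (a j) - X (a j.+1))).
rewrite (@telescope_sumr_eq _ 0 M (fun j => - X (a j))) //; last first.
  by move=> j _; rewrite opprK addrC.
have /andP[x0 _] := X01 (a M); have /andP[_ x1] := X01 (a 0%N).
by rewrite opprK addrC lerBlDr (le_trans x1) // lerDl.
Qed.

(** * Compactness of laws on the unit interval *)

Lemma ultra_cvg_segment (R : realType) (U : set_system nat) (x : nat -> R) :
  UltraFilter U -> (forall N, 0 <= x N <= 1) ->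
  exists2 l : R, 0 <= l <= 1 & x N @[N --> U] --> l.
Proof.
move=> UU x01.
have xU : (x @ U) `[0, 1]%classic.
  by apply: (@filterE _ U) => N /=; rewrite in_itv /= x01.
have [l [l01 cl]] := @segment_compact R 0 1 (x @ U) _ xU.
exists l; first by move: l01; rewrite /= in_itv.
move=> V Vl; have [//|UC] := in_ultra_setVsetC (x @^-1` V) UU.
have [y [yC yV]] := cl (~` V) V UC Vl; exfalso; exact: yC.
Qed.

Lemma Rintegral_uniform01 (R : realType) (f : R -> R) (K : R) :
  measurable_fun setT f -> (forall u, `|f u| <= K) ->
  \int[uniform_prob (@ltr01 R)]_u f u = \int[@lebesgue_measure R]_(u in `[0, 1[) f u.
Proof.
move=> mf fK.
have fb (A : set R) : [bounded f x | x in A].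
  exists K; split; first by rewrite num_real.
  by move=> k kK u _ /=; rewrite (le_trans (fK u)) // ltW.
have fi : (uniform_prob (@ltr01 R)).-integrable setT (EFin \o f).
  apply: measurable_bounded_integrable => //. 
  exact: (le_lt_trans (probability_le1 (uniform_prob (@ltr01 R)) measurableT) (ltry 1)).
have ci : (uniform_prob (@ltr01 R)).-integrable setT (EFin \o cst K).
  exact: finite_measure_integrable_cst.
have mu01 b : (@lebesgue_measure R [set` Interval (BLeft 0%R) (BSide b 1%R)] < +oo)%E.
  by rewrite lebesgue_measure_itv /= lte_fin ltr01 -EFinB ltry.
have fi' b : (@lebesgue_measure R).-integrable [set` Interval (BLeft 0) (BSide b 1)] (EFin \o f).
  by apply: measurable_bounded_integrable => //; [exact: mu01|exact: measurable_funTS].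
have ci' : (@lebesgue_measure R).-integrable `[0, 1] (EFin \o cst K).
  apply: measurable_bounded_integrable => //; first exact: mu01.
  by exists `|K|; split=> // k kK u _ /=; rewrite ltW.
(* Adding [K] makes the integrand nonnegative, as [integral_uniform] requires; the constant cancels
   afterwards. *)
have : \int[uniform_prob (@ltr01 R)]_u (f u + K) =
       \int[@lebesgue_measure R]_(u in `[0, 1]) (f u + K).
  rewrite /Rintegral integral_uniform ?subr0 ?invr1 ?mul1e //.
    by apply/measurable_EFinP; exact: measurable_funD.
  by move=> u; rewrite lee_fin -lerBlDr sub0r; have := fK u; rewrite ler_norml => /andP[].
rewrite RintegralD // [RHS]RintegralD // !Rintegral_cst //.
have -> : fine (@lebesgue_measure R `[0, 1]) = 1.
  by rewrite lebesgue_measure_itv /= lte_fin ltr01 /= oppr0 addr0.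
have -> : fine (uniform_prob (@ltr01 R) setT) = 1.
  by rewrite (probability_setT (uniform_prob (@ltr01 R))).
by move/addIr => ->; rewrite Rintegral_itv_bndo_bndc.
Qed.

(** Composition with [cl] extends to the line a function that is Lipschitz only on the unit
    interval, such as a kernel with a pole outside it. *)
Lemma clamp_unit_interval (R : realType) :
  exists cl : R -> R, [/\ forall t, 0 <= cl t <= 1,
    forall t, 0 <= t <= 1 -> cl t = t & forall s t, `|cl s - cl t| <= `|s - t|].
Proof.
exists (fun t => Num.max 0 (Num.min 1 t)); split.
- by move=> t; rewrite le_max lexx ge_max ler01 ge_min lexx.
- by move=> t /andP[t0 t1]; rewrite min_r // max_r.
move=> s t; wlog st : s t / s <= t => [H|].
  by have [/H//|/ltW/H] := leP s t; rewrite distrC (distrC t).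
rewrite [leRHS]ler0_norm ?subr_le0 // ler_norml.
have [t1|t1] := leP 1 t; have [s1|s1] := leP 1 s;
  rewrite ?(max_r (@ler01 R)); try (apply/andP; split; lra).
  have [s0|s0] := leP 0 s; apply/andP; split; lra.
by have [t0|t0] := leP 0 t; have [s0|s0] := leP 0 s; apply/andP; split; lra.
Qed.

(* Helly's selection theorem for finitely supported laws, along an ultrafilter: the
   quantile functions converge pointwise and the limit law is that of the limit. *)
Lemma atomic_laws_ultralimit (R : realType) (U : set_system nat)
    (m : nat -> nat) (c p : nat -> nat -> R) :
  UltraFilter U ->
  (forall N j, 0 <= c N j) -> (forall N, \sum_(j < (m N).+1) c N j = 1) ->
  (forall N j, (j <= m N)%N -> 0 <= p N j <= 1) ->
  (forall N i j, (i <= j <= m N)%N -> p N j <= p N i) ->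
  exists mu : probability (measurableTypeR R) R, mu `[0, 1]%classic = 1%E /\
    forall (g : R -> R) L,
      (forall s t, 0 <= s <= 1 -> 0 <= t <= 1 -> `|g s - g t| <= L * `|s - t|) ->
      \sum_(j < (m N).+1) c N j * g (p N j) @[N --> U] -->
      \int[mu]_(t in `[0, 1]) g t.
Proof.
move=> UU c0 c1 p01 pni.
have /choice[X XP] N := step_quantile (c0 N) (c1 N) (@p01 N) (@pni N).
have /choice[Y YP] u : exists l : R, 0 <= l <= 1 /\ X N u @[N --> U] --> l.
  have [|l l01 Xl] := @ultra_cvg_segment R U (X ^~ u) UU.
    by move=> N; have [_ + _] := XP N; exact.
  by exists l.
have Y01 u : 0 <= Y u <= 1 by case: (YP u).
have Yni : {homo Y : u v / u <= v >-> v <= u}.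
  move=> u v uv; have [_ cu] := YP u; have [_ cv] := YP v.
  apply: (ler_cvg_to cv cu); apply: filterE => N.
  by have [+ _ _] := XP N; apply.
(* Riemann sums on [M] points are within [L / M] of both integrals, uniformly in [N]; only [M]
   sample values have to converge along [U]. *)
have cvgY (g : R -> R) L : (forall s t, `|g s - g t| <= L * `|s - t|) ->
   \int[@lebesgue_measure R]_(u in `[0, 1[) g (X N u) @[N --> U] -->
   \int[@lebesgue_measure R]_(u in `[0, 1[) g (Y u).
  move=> gL.
  have L0 : 0 <= L by have := gL 1 0; rewrite subr0 normr1 mulr1; apply: le_trans.
  apply/cvgrPdist_lt => e e0.
  pose M := (Num.bound (L / (e / 3))).+1.
  have LM : L / M%:R < e / 3.
    rewrite ltr_pdivrMr ?ltr0n // mulrC -ltr_pdivrMr ?divr_gt0 //.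
    by rewrite (lt_trans (archi_boundP _)) ?ltr_nat ?ltnSn // !divr_ge0 // ltW.
  have cS : \sum_(j < M) g (X N (j%:R / M%:R)) / M%:R @[N --> U] -->
            \sum_(j < M) g (Y (j%:R / M%:R)) / M%:R.
    apply: cvg_big => [|j _]; first exact: add_continuous.
    apply: cvgMr_tmp.
    apply: continuous_cvg; first exact: (continuous_of_lipschitz gL).
    by have [] := YP (j%:R / M%:R).
  near=> N.
  have [Nni N01 _] := XP N.
  have := @monotone_riemann_sum R g (X N) L M gL isT Nni N01.
  have := @monotone_riemann_sum R g Y L M gL isT Yni Y01.
  have : `|\sum_(j < M) g (Y (j%:R / M%:R)) / M%:R -
     \sum_(j < M) g (X N (j%:R / M%:R)) / M%:R| < e / 3.
    by near: N; apply: cvgr_dist_lt => //; rewrite divr_gt0.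
  rewrite !ltr_norml !ler_norml; move: LM.
  set a := (L / _); set b := \sum_(_ < _) _; set d := \sum_(_ < _) _.
  by move=> ? /andP[? ?] /andP[? ?] /andP[? ?]; apply/andP; split; lra.
(* The limit law is the image under [Y] of the uniform law; monotonicity is what makes [Y]
   measurable. *)
have mY : measurable_fun [set: measurableTypeR R] (Y : measurableTypeR R -> measurableTypeR R).
  exact: nonincreasing_measurable.
pose YM : {mfun measurableTypeR R >-> measurableTypeR R} := 
  MeasurableFun.Pack (MeasurableFun.Class (isMeasurableFun.Build _ _ _ _ _ mY)).
pose P : probability (measurableTypeR R) R := uniform_prob (@ltr01 R).
pose mu : probability (measurableTypeR R) R := distribution P YM.
exists mu; split.
  rewrite /mu /= /distribution /pushforward /=.
  rewrite (_ : _ @^-1` _ = setT) ?probability_setT //.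
  by apply/seteqP; split=> // u _ /=; rewrite in_itv /= Y01.
move=> g L gL.
have [cl [cl01 clE clL]] := clamp_unit_interval R.
have L0 : 0 <= L.
  have := gL 1 0; rewrite subr0 normr1 mulr1 !lexx !ler01 => /(_ isT isT).
  exact: le_trans.
have gclL s t : `|(g \o cl) s - (g \o cl) t| <= L * `|s - t|.
  by rewrite (le_trans (gL _ _ (cl01 _) (cl01 _))) // ler_wpM2l.
have <- : \int[@lebesgue_measure R]_(u in `[0, 1[) (g \o cl) (Y u) =
   \int[mu]_(t in `[0, 1]) g t.
  have bd u : `|((g \o cl) \o Y) u| <= `|(g \o cl) 0| + `|L|.
    exact: lipschitz_bounded gclL (Y01 u).
  have mg : measurable_fun setT (g \o cl).
    exact: continuous_measurable_fun (continuous_of_lipschitz gclL).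
  have mgY := lipschitz_comp_measurable gclL Yni.
  rewrite -(Rintegral_uniform01 mgY bd).
  rewrite (@eq_Rintegral _ _ _ mu _ (g \o cl) g); last first.
    by move=> t; rewrite inE /= in_itv => t01 /=; rewrite clE.
  congr fine; rewrite integral_pushforward //=.
  - congr (integral _ _ _); apply/seteqP; split=> // u _ /=.
    by rewrite in_itv /= Y01.
  - exact/measurable_EFinP.
  rewrite (_ : _ @^-1` _ = setT); last first.
    by apply/seteqP; split=> // u _ /=; rewrite in_itv /= Y01.
  apply: measurable_bounded_integrable => //.
    exact: (le_lt_trans (probability_le1 P measurableT) (ltry 1)).
  exists (`|(g \o cl) 0| + `|L|); split; first by rewrite num_real.
  by move=> k kK u _ /=; rewrite (le_trans (bd u)) // ltW.
apply: cvg_trans (cvgY _ _ gclL).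
apply: near_eq_cvg; apply: filterE => N.
have [_ _ E] := XP N; rewrite (E _ _ gclL); apply: eq_bigr => j _ /=.
by rewrite clE // p01 // -ltnS.
Unshelve. all: by end_near. Qed.

(** * Discretisation of the density *)

(** With [h t = t * sigma' t / sigma t], the derivative of the ratio at [u] is a positive factor
    times [h (q * u) - h u], which is nonnegative because [h] decreases and [q * u <= u]. *)
Lemma ratio_dilation_monotone (R : realType) (sigma : R -> R) (q : R) :
  (forall t : R, t \in `]0, 1[ -> derivable sigma t 1) ->
  (forall t : R, t \in `]0, 1[ -> 0 < sigma t) ->
  {in `]0, 1[ &, {homo (fun t : R => t * derive1 sigma t / sigma t) : s t /~ s <= t}} ->
  0 < q < 1 -> forall s t : R, 0 < s -> s <= t -> t < 1 ->
  sigma (q * s) / sigma s <= sigma (q * t) / sigma t.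
Proof.
move=> sd sp sdecr /andP[q0 q1] s t s0 st t1.
have qu01 (u : R) : 0 < u < 1 -> q * u \in `]0, 1[.
  move=> /andP[u0 u1]; rewrite in_itv /= mulr_gt0 //=.
  by rewrite (le_lt_trans _ q1) // ler_piMr // ltW.
pose ds : R -> R := derive1 sigma.
pose dphi (u : R) := sigma (q * u) * (- sigma u ^- 2 * ds u) +
  (sigma u)^-1 * (ds (q * u) * (q * 1)).
have der (u : R) : 0 < u < 1 ->
    is_derive u 1 (fun u => sigma (q * u) / sigma u) (dphi u).
  move=> u01.
  have d1 : is_derive u 1 sigma (ds u).
    by apply: DeriveDef; [exact: sd|rewrite /ds derive1E].
  have d2 : is_derive (q * u) 1 sigma (ds (q * u)).
    by apply: DeriveDef; [exact/sd/qu01|rewrite /ds derive1E].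
  have d3 : is_derive u 1 (fun u => q * u) (q * 1).
    exact: (is_deriveZ q (is_derive_id u 1)).
  have d4 := is_derive1_comp d2 d3.
  have nz : sigma u != 0 by rewrite gt_eqF // sp.
  have d5 := is_deriveV nz d1.
  exact: is_deriveM d4 d5.
have st01 (u : R) : u \in `[s, t] -> 0 < u < 1.
  by rewrite in_itv /= => /andP[su ut]; rewrite (lt_le_trans s0 su) (le_lt_trans ut t1).
have [| |c cst E] := @MVT_segment R (fun u => sigma (q * u) / sigma u) dphi s t st.
  by move=> u ust; apply/der/st01; move: ust; rewrite !in_itv /= => /andP[/ltW -> /ltW ->].
  by apply: derivable_within_continuous => u /st01 /der [].
rewrite -subr_ge0 E mulr_ge0 ?subr_ge0 //.
have /andP[c0 c1] := st01 _ cst.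
have cc : c \in `]0, 1[ by rewrite in_itv /= c0.
have qc := qu01 c (st01 _ cst).
have sc0 := sp _ cc; have sqc0 := sp _ qc.
have -> : dphi c = sigma (q * c) / (c * sigma c) *
   (q * c * ds (q * c) / sigma (q * c) - c * ds c / sigma c).
  by rewrite /dphi; field; rewrite !gt_eqF.
rewrite mulr_ge0 ?divr_ge0 ?mulr_ge0 ?(ltW c0) ?(ltW sc0) ?(ltW sqc0) // subr_ge0.
apply: sdecr => //; rewrite ler_piMl ?ltW //.
Qed.

Lemma Rintegral_dilation (R : realType) (f : R -> R) (q a b : R) :
  0 < q -> a <= b -> {in `[q * a, q * b], continuous f} ->
  \int[@lebesgue_measure R]_(t in `[q * a, q * b[) f t =
  q * \int[@lebesgue_measure R]_(t in `[a, b[) f (q * t).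
Proof.
move=> q0 ab fc.
have dF (u : R) : is_derive u 1 (fun u => q * u) (q * 1).
  exact: (is_deriveZ q (is_derive_id u 1)).
have F1 : derive1 (fun u : R => q * u) = cst q.
  by apply/funext => u; rewrite derive1E derive_val mulr1.
have Fc : continuous (fun u : R => q * u) by move=> u; exact: mulrl_continuous.
have fcw : {within `[q * a, q * b], continuous f}.
  by apply: continuous_in_subspaceT => t; rewrite inE; exact: fc.
have gcw : {within `[a, b], continuous (fun t => f (q * t))}.
  apply: continuous_in_subspaceT => t; rewrite inE /= in_itv /= => /andP[at_ tb].
  apply: continuous_comp; first exact: Fc.
  by apply: fc; rewrite in_itv /= !ler_pM2l // at_.
have fi : (@lebesgue_measure R).-integrable `[q * a, q * b] (EFin \o f).
  by apply: continuous_compact_integrable => //; exact: segment_compact.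
have gi : (@lebesgue_measure R).-integrable `[a, b] (EFin \o (fun t => f (q * t))).
  by apply: continuous_compact_integrable => //; exact: segment_compact.
have sub (x y : R) : `[x, y[%classic `<=` `[x, y]%classic.
  by apply: subset_itvl; rewrite bnd_simp.
have ab' : q * a <= q * b by rewrite ler_pM2l.
rewrite Rintegral_itv_bndo_bndc; last first.
  by apply: integrableS gi => //; exact: sub.
rewrite Rintegral_itv_bndo_bndc; last first.
  by apply: integrableS fi => //; exact: sub.
rewrite -RintegralZl // /Rintegral; congr fine.
rewrite (@integration_by_substitution_increasing _ (fun u => q * u) f) //.
- by apply: eq_integral => u _; rewrite F1 /= mulrC.
- by move=> u v _ _ uv; rewrite ltr_pM2l.
- by rewrite F1 => u _; exact: cst_continuous.
- by rewrite F1; exact: is_cvg_cst.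
- by rewrite F1; exact: is_cvg_cst.
- split; first by move=> u _; have [] := dF u.
    exact/cvg_at_right_filter/Fc.
  exact/cvg_at_left_filter/Fc.
Qed.

Lemma continuous_itv_integrable (R : realType) (f : R -> R) (a b : R) :
  {in `[a, b], continuous f} -> (@lebesgue_measure R).-integrable `[a, b[ (EFin \o f).
Proof.
move=> fc; have fi : (@lebesgue_measure R).-integrable `[a, b] (EFin \o f).
  apply: continuous_compact_integrable; first exact: segment_compact.
  by apply: continuous_in_subspaceT => t; rewrite inE; exact: fc.
by apply: integrableS fi => //; apply: subset_itvl; rewrite bnd_simp.
Qed.

Lemma Rintegral_itv_gt0 (R : realType) (f : R -> R) (a b : R) : a < b ->
  {in `[a, b], continuous f} -> (forall t, t \in `[a, b] -> 0 < f t) ->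
  0 < \int[@lebesgue_measure R]_(t in `[a, b[) f t.
Proof.
move=> ab fc f0.
have [|c cab fcmin] := @EVT_min R f a b (ltW ab).
  by apply: continuous_in_subspaceT => t; rewrite inE; exact: fc.
have : 0 < f c * (b - a) by rewrite mulr_gt0 ?subr_gt0 // f0.
rewrite -Rintegral_itv_cst ?ltW // => /lt_le_trans; apply.
apply: le_Rintegral => //.
- by apply: continuous_itv_integrable => t _; exact: cst_continuous.
- exact: continuous_itv_integrable.
move=> t; rewrite /= in_itv /= => /andP[at_ tb].
by apply: fcmin; rewrite in_itv /= at_ ltW.
Qed.

(* The weight placed at [q ^ i]; the interval is shifted by one step so that its closure
   stays inside the open unit interval even for [i = 0]. *)
Definition geometric_weight (R : realType) (sigma : R -> R) (q : R) (i : nat) : R :=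
  \int[@lebesgue_measure R]_(t in `[q ^+ i.+2, q ^+ i.+1[) sigma t.

Section density.
Variables (R : realType) (sigma : R -> R).
Hypothesis sd : forall t : R, t \in `]0, 1[ -> derivable sigma t 1.
Hypothesis sp : forall t : R, t \in `]0, 1[ -> 0 < sigma t.
Local Notation mu := (@lebesgue_measure R).

Let sc (t : R) : t \in `]0, 1[ -> {for t, continuous sigma}.
Proof. by move=> /sd; rewrite derivable1_diffP; exact: differentiable_continuous. Qed.

Let sc_in (a b : R) : 0 < a -> b < 1 -> {in `[a, b], continuous sigma}.
Proof.
move=> a0 b1 t; rewrite in_itv /= => /andP[at_ tb]; apply: sc.
by rewrite in_itv /= (lt_le_trans a0) // (le_lt_trans tb).
Qed.

Lemma geometric_weight_gt0 (q : R) (i : nat) : 0 < q < 1 -> 0 < geometric_weight sigma q i.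
Proof.
move=> /andP[q0 q1].
have qi1 : q ^+ i.+1 < 1 by rewrite exprn_ilt1 // ltW.
apply: Rintegral_itv_gt0.
- by rewrite ltr_iXn2l.
- by apply: sc_in => //; rewrite exprn_gt0.
move=> t; rewrite in_itv /= => /andP[at_ tb]; apply: sp.
by rewrite in_itv /= (le_lt_trans tb) // (lt_le_trans _ at_) // exprn_gt0.
Qed.

(** Let [r] be the value of [q * sigma (q * t) / sigma t] at the common endpoint [b]: it is an upper
    bound of that function on the left interval and a lower bound on the right one. The factor [q]
    is the Jacobian of the dilation. *)
Lemma dilation_ratio_bounds (q a b d : R) :
  {in `]0, 1[ &, {homo (fun t : R => t * derive1 sigma t / sigma t) : s t /~ s <= t}} ->
  0 < q < 1 -> 0 < a -> a <= b -> b <= d -> d < 1 ->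
  exists r, \int[mu]_(t in `[q * a, q * b[) sigma t <= r * \int[mu]_(t in `[a, b[) sigma t /\
   r * \int[mu]_(t in `[b, d[) sigma t <= \int[mu]_(t in `[q * b, q * d[) sigma t.
Proof.
move=> sdecr q01 a0 ab bd d1; have /andP[q0 q1] := q01.
have b0 := lt_le_trans a0 ab; have b1 := le_lt_trans bd d1.
have q01u (u : R) : 0 < u -> u < 1 -> q * u < 1.
  by move=> u0 u1; rewrite (lt_trans _ u1) // gtr_pMl.
have mono := ratio_dilation_monotone sd sp sdecr q01.
have s0 (u : R) : 0 < u -> u < 1 -> 0 < sigma u.
  by move=> u0 u1; apply: sp; rewrite in_itv /= u0.
have dil (u v : R) : 0 < u -> u <= v -> v < 1 ->
   mu.-integrable `[u, v[ (EFin \o (fun t => sigma (q * t))).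
  move=> u0 uv v1; apply: continuous_itv_integrable => t.
  rewrite in_itv /= => /andP[ut tv].
  have t0 := lt_le_trans u0 ut.
  apply: continuous_comp; first exact: mulrl_continuous.
  by apply: sc; rewrite in_itv /= mulr_gt0 // q01u // (le_lt_trans tv).
have sint (u v : R) : 0 < u -> v < 1 -> mu.-integrable `[u, v[ (EFin \o sigma).
  by move=> u0 v1; apply: continuous_itv_integrable; exact: sc_in.
exists (q * (sigma (q * b) / sigma b)); split.
  rewrite Rintegral_dilation //; last first.
    by apply: sc_in; rewrite ?mulr_gt0 ?q01u.
  rewrite -mulrA ler_pM2l // -RintegralZl //; last exact: sint.
  apply: le_Rintegral => //; first exact: dil.
    exact: (integrableZl _ _ (sint _ _ a0 b1)).
  move=> t; rewrite /= in_itv /= => /andP[at_ tb].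
  have t0 := lt_le_trans a0 at_; have t1 := lt_trans tb b1.
  by rewrite -ler_pdivrMr ?s0 // mono // ltW.
rewrite [leRHS]Rintegral_dilation //; last first.
  by apply: sc_in; rewrite ?mulr_gt0 ?q01u // (lt_le_trans b0).
rewrite -mulrA ler_pM2l // -RintegralZl //; last exact: sint.
apply: le_Rintegral => //; last 2 first.
- exact: dil.
- move=> t; rewrite /= in_itv /= => /andP[bt td].
  have t0 := lt_le_trans b0 bt; have t1 := lt_trans td d1.
  by rewrite -ler_pdivlMr ?s0 // mono.
exact: (integrableZl _ _ (sint _ _ b0 d1)).
Qed.

Lemma geometric_weight_log_concave (q : R) (i : nat) :
  {in `]0, 1[ &, {homo (fun t : R => t * derive1 sigma t / sigma t) : s t /~ s <= t}} ->
  0 < q < 1 ->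
  geometric_weight sigma q i.+2 * geometric_weight sigma q i <=
    geometric_weight sigma q i.+1 ^+ 2.
Proof.
move=> sdecr q01; set w := geometric_weight sigma q; have /andP[q0 q1] := q01.
have qle j k : (j <= k)%N -> q ^+ k <= q ^+ j.
  by move=> jk; apply: ler_wiXn2l => //; apply: ltW.
have w0 j : 0 < w j by exact: geometric_weight_gt0.
have qi1 : q ^+ i.+1 < 1 by rewrite exprn_ilt1 // ltW.
(* The undilated intervals carry [w i.+1] and [w i], the dilated ones [w i.+2] and [w i.+1]. *)
have [r []] := @dilation_ratio_bounds q (q ^+ i.+3) (q ^+ i.+2) (q ^+ i.+1) sdecr q01
  (exprn_gt0 _ q0) (qle _ _ (leqnSn _)) (qle _ _ (leqnSn _)) qi1.
rewrite -!exprS => h1 h2.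
have {}h1 : w i.+2 <= r * w i.+1 by [].
have {}h2 : r * w i <= w i.+1 by [].
apply: (@le_trans _ _ (r * w i.+1 * w i)); first by rewrite ler_pM2r.
by rewrite mulrAC expr2 ler_pM2r.
Qed.

Hypothesis sint1 : (\int[mu]_(t in `]0%R, 1%R[) (sigma t)%:E = 1)%E.

Let sge0 (t : R) : `]0, 1[%classic t -> 0 <= sigma t.
Proof. by move=> t01; apply/ltW/sp. Qed.

Lemma density_integrable : mu.-integrable `]0, 1[ (EFin \o sigma).
Proof.
apply/integrableP; split.
  apply/measurable_EFinP; apply: open_continuous_measurable_fun => //.
  by move=> t; rewrite inE; exact: sc.
under eq_integral => t.
  rewrite inE => t01; rewrite /= ger0_norm ?sge0 //; over.
by rewrite sint1 ltry.
Qed.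

Lemma density_mass : \int[mu]_(t in `]0, 1[) sigma t = 1.
Proof. by rewrite /Rintegral sint1. Qed.

(** A finite grid misses both ends of the unit interval, where [sigma] may be unbounded; this makes
    the lost mass small. In the proof, [k.+2] keeps [a k <= 1 / 2], so that the endpoints stay in
    order. *)
Lemma density_mass_interior (e : R) : 0 < e ->
  exists a b : R, [/\ 0 < a, a <= b, b < 1 & 1 - e < \int[mu]_(t in `[a, b[) sigma t].
Proof.
move=> e0; pose a (k : nat) : R := k.+2%:R^-1.
have a0 k : 0 < a k by rewrite invr_gt0 ltr0n.
have a2 k : a k <= 2^-1 by rewrite lef_pV2 ?posrE ?ltr0n // ler_nat.
have ale k l : (k <= l)%N -> a l <= a k.
  by move=> kl; rewrite lef_pV2 ?posrE ?ltr0n // ler_nat !ltnS.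
pose F k : set R := `[a k, 1 - a k[%classic.
have FE : \bigcup_k F k = `]0, 1[%classic.
  apply/seteqP; split=> t /=.
    move=> [k _]; rewrite /F /= !in_itv /= => /andP[ta tb].
    by rewrite (lt_le_trans (a0 k)) //= (lt_trans tb) // gtrBl.
  rewrite in_itv /= => /andP[t0 t1]; pose m := Num.min t (1 - t).
  have m0 : 0 < m by rewrite lt_min t0 subr_gt0.
  have am : a (Num.bound m^-1) < m.
    rewrite -[ltRHS]invrK ltf_pV2 ?posrE ?ltr0n ?invr_gt0 //.
    apply: lt_trans (archi_boundP _) _; first by rewrite invr_ge0 ltW.
    by rewrite ltr_nat.
  move: am; rewrite lt_min => /andP[am1 am2].
  by exists (Num.bound m^-1) => //; rewrite /F /= in_itv /= ltW //= ltrBrDl -ltrBrDr.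
have Fm k : measurable (F k) by exact: measurable_itv.
have Fsub k : F k `<=` `]0, 1[ by rewrite -FE; exact: bigcup_sup.
have si := density_integrable.
have ndF : nondecreasing_seq F.
  move=> k l kl; apply/subsetPset; apply: subset_itv; rewrite bnd_simp ?ale //.
  by rewrite lerD2l lerN2 ale.
have mF k : measurable_fun (F k) (EFin \o sigma).
  by apply: measurable_funS (measurable_int _ si).
have : ((\int[mu]_(x in F i) (sigma x)%:E) @[i --> \oo] -->
    \int[mu]_(x in \bigcup_i F i) (sigma x)%:E)%E.
  apply: ge0_nondecreasing_set_cvg_integral => // k t /Fsub t01.
  by rewrite lee_fin sge0.
rewrite FE sint1 => /fine_cvgP[_].
move=> /cvgr_dist_lt /(_ e e0)[k _ /(_ k (leqnn k)) /=].
rewrite ltr_norml => /andP[_]; rewrite ltrBlDr -ltrBlDl => ?.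
exists (a k), (1 - a k); split => //.
- by have := a2 k; lra.
- by rewrite gtrBl.
Qed.


Lemma density_integrable_mul (g : R -> R) (L : R) :
  (forall s t, 0 <= s <= 1 -> 0 <= t <= 1 -> `|g s - g t| <= L * `|s - t|) ->
  (forall t, 0 <= t <= 1 -> `|g t| <= L) ->
  mu.-integrable `]0, 1[ (EFin \o (fun t => g t * sigma t)).
Proof.
move=> gL gb; have [cl [cl01 clE clL]] := clamp_unit_interval R.
have L0 : 0 <= L by apply: le_trans (gb 0 _); rewrite ?lexx ?ler01.
have gclL s t : `|(g \o cl) s - (g \o cl) t| <= L * `|s - t|.
  by rewrite (le_trans (gL _ _ (cl01 _) (cl01 _))) // ler_wpM2l.
have in01 (t : R) : `]0, 1[%classic t -> 0 <= t <= 1.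
  by rewrite /= in_itv /= => /andP[/ltW -> /ltW ->].
apply: (integrableMr _ _ _ density_integrable) => //.
  apply: (eq_measurable_fun (g \o cl)).
    by move=> t; rewrite inE => /in01 t01 /=; rewrite clE.
  apply: measurable_funTS.
  exact: continuous_measurable_fun (continuous_of_lipschitz gclL).
exists L; split; first by rewrite num_real.
move=> K LK t /in01 t01 /=; exact: le_trans (gb _ t01) (ltW LK).
Qed.

(** The first error comes from the cells: the mass of [[q ^ i.+2, q ^ i.+1[] is placed at [q ^ i],
    at distance at most [1 - q ^ 2]. The second is the bound [L] on [g] times the mass that the grid
    misses. *)
Lemma geometric_sum_estimate (g : R -> R) (L q a b : R) (n : nat) :
  (forall s t, 0 <= s <= 1 -> 0 <= t <= 1 -> `|g s - g t| <= L * `|s - t|) ->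
  (forall t, 0 <= t <= 1 -> `|g t| <= L) ->
  0 < q < 1 -> 0 < a -> a <= b -> b <= q -> q ^+ n.+2 <= a ->
  `|\int[mu]_(t in `]0, 1[) (g t * sigma t) -
    \sum_(i < n.+1) geometric_weight sigma q i * g (q ^+ i)| <=
  L * (1 - q ^+ 2) + L * (1 - \int[mu]_(t in `[a, b[) sigma t).
Proof.
move=> gL gb q01 a0 ab bq qa; have /andP[q0 q1] := q01.
have L0 : 0 <= L by apply: le_trans (gb 0 _); rewrite ?lexx ?ler01.
pose I : set R := `[q ^+ n.+2, q[%classic.
have mI : measurable I by exact: measurable_itv.
have qn j : 0 < q ^+ j by rewrite exprn_gt0.
have ID : I `<=` `]0, 1[.
  by apply: subset_itv; rewrite bnd_simp // ltW.
have si := density_integrable.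
have gsi := density_integrable_mul gL gb.
have split_int (h : R -> R) : mu.-integrable `]0, 1[ (EFin \o h) ->
   \int[mu]_(t in `]0, 1[) h t = \int[mu]_(t in I) h t +
     \int[mu]_(t in `]0, 1[ `\` I) h t.
  move=> hi; rewrite -{1}(setDUK ID) Rintegral_setU ?setDUK //.
    exact: measurableD.
  by rewrite disj_set2E setDIK.
have mDI : measurable (`]0, 1[ `\` I) by exact: measurableD.
have siI : mu.-integrable I (EFin \o sigma) by apply: integrableS si.
have gsiI : mu.-integrable I (EFin \o (fun t => g t * sigma t)) by apply: integrableS gsi.
have siD : mu.-integrable (`]0, 1[ `\` I) (EFin \o sigma).
  by apply: integrableS si.
have gsiD : mu.-integrable (`]0, 1[ `\` I) (EFin \o (fun t => g t * sigma t)).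
  by apply: integrableS gsi.
have mass := split_int _ si; rewrite density_mass in mass.
have massI : \int[mu]_(t in `[a, b[) sigma t <= \int[mu]_(t in I) sigma t.
  have abI : `[a, b[ `<=` I by apply: subset_itv; rewrite bnd_simp.
  rewrite -(setDUK abI) Rintegral_setU ?setDUK //.
  - by rewrite lerDl; apply: Rintegral_ge0 => t [/ID t01 _]; exact: sge0.
  - exact: measurableD.
  - by rewrite disj_set2E setDIK.
rewrite split_int // addrAC; apply: le_trans (ler_normD _ _) _; apply: lerD; last first.
  apply: le_trans (le_normr_Rintegral _ gsiD) _ => //.
  apply: (@le_trans _ _ (L * \int[mu]_(t in `]0, 1[ `\` I) sigma t)); last first.
    by rewrite ler_wpM2l //; move: mass massI; lra.
  rewrite -RintegralZl //; apply: le_Rintegral => //.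
  - exact: integrable_norm.
  - exact: (integrableZl _ _ siD).
  move=> t [t01 _]; rewrite normrM (ger0_norm (sge0 t01)) ler_wpM2r ?sge0 //.
  by apply: gb; move: t01; rewrite /= in_itv /= => /andP[/ltW -> /ltW ->].
(* The partition has to increase, so the grid is read backwards: weight [i] belongs to cell
   [n - i]. *)
pose c j := q ^+ (n.+2 - j).
have E (z : nat -> R) : \sum_(i < n.+1) z i * geometric_weight sigma q i =
   \sum_(j < n.+1) z (n - j)%N * \int[mu]_(t in `[c j, c j.+1[) sigma t.
  rewrite (reindex_inj rev_ord_inj) /=; apply: eq_bigr => j _.
  have jn : (j <= n)%N by rewrite -ltnS.
  by rewrite subSS /c /geometric_weight subSS (subSn (leqW jn)) (subSn jn).
have cI : `[c 0%N, c n.+1[%classic = I by rewrite /c /I subn0 subSnn expr1.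
have := @step_estimate R c g sigma (fun j => g (q ^+ (n - j))) (fun=> L * (1 - q ^+ 2)) n.+1.
rewrite cI => H; under eq_bigr => i _ do rewrite mulrC.
rewrite (E (fun i => g (q ^+ i))); apply: le_trans (H _ siI gsiI _ _) _.
- by move=> j jn; rewrite /c ler_wiXn2l ?ltW // leq_sub2l.
- move=> u; rewrite {1}/c {1}/c subn0 subSnn expr1 => uI; apply: sge0; apply: ID.
  by rewrite /I /= in_itv /=.
- move=> j u jn; rewrite /c subSS => /andP[u1 u2].
  have un : (n.+2 - j = (n - j).+2)%N by rewrite (subSn (ltnW jn)) (subSn (jn : (j <= n)%N)).
  have un1 : (n.+1 - j = (n - j).+1)%N by rewrite (subSn (jn : (j <= n)%N)).
  have qi1 i : q ^+ i <= 1 by rewrite exprn_ile1 ?ltW.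
  have u01 : 0 <= u <= 1.
    by apply/andP; split; [exact: le_trans (ltW (qn _)) u1|exact: le_trans (ltW u2) (qi1 _)].
  apply: le_trans (gL _ _ u01 _) _; first by rewrite qi1 ltW.
  rewrite ler_wpM2l // ler0_norm; last first.
    rewrite subr_le0 (le_trans (ltW u2)) // un1 exprS ler_piMl ?ltW //.
  rewrite opprB; apply: (@le_trans _ _ (q ^+ (n - j) * (1 - q ^+ 2))).
    by rewrite mulrBr mulr1 -exprD addn2 -un lerD2l lerN2.
  by rewrite ler_piMl // subr_ge0.
rewrite -mulr_sumr -[leRHS]mulr1 ler_wpM2l //.
  by rewrite mulr_ge0 // subr_ge0 exprn_ile1 ?ltW.
have -> : \sum_(j < n.+1) \int[mu]_(t in `[c j, c j.+1[) sigma t = \int[mu]_(t in I) sigma t.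
  rewrite -cI Rintegral_partition //; last by rewrite cI.
  by move=> j jn; rewrite /c ler_wiXn2l ?ltW // leq_sub2l.
rewrite mass lerDl; apply: Rintegral_ge0 => t [t01 _]; exact: sge0.
Qed.

End density.

(** * The quotient *)

(** [q] is the [k]-th root of [y]; [expR u >= 1 + u] reduces the bound to [k >= - ln y / d]. *)
Lemma root_near_one (R : realType) (y d : R) : 0 < y < 1 -> 0 < d ->
  exists (q : R) (k : nat), [/\ 0 < q < 1, q ^+ k = y & 1 - d <= q].
Proof.
move=> /andP[y0 y1] d0; have l0 : ln y < 0 by rewrite ln_lt0 // y0.
pose k := (Num.bound (- ln y / d)).+1.
have kR : (0 : R) < k%:R by rewrite ltr0n.
exists (expR (ln y / k%:R)), k; split.
- by rewrite expR_gt0 expR_lt1 pmulr_llt0 ?invr_gt0.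
- by rewrite -expRM_natl mulrC divfK ?gt_eqF // lnK.
- apply: le_trans (expR_ge1Dx _); rewrite lerD2l lerNl -mulNr.
  rewrite ler_pdivrMr // mulrC -ler_pdivrMr // ltW //.
  apply: lt_trans (archi_boundP _) _; last by rewrite ltr_nat.
  by rewrite divr_ge0 ?oppr_ge0 // ltW.
Qed.

Lemma geometric_power_le (R : realType) (q a : R) : 0 < q < 1 -> 0 < a ->
  exists n : nat, q ^+ n.+2 <= a.
Proof.
move=> /andP[q0 q1] a0.
have : q ^+ n @[n --> \oo] --> (0 : R) by apply: cvg_expr; rewrite ger0_norm // ltW.
move=> /cvgr_dist_lt /(_ a a0)[n _ /(_ n.+2)].
rewrite /= sub0r normrN ger0_norm ?exprn_ge0 ?(ltW q0) // => H.
by exists n; apply/ltW/H; rewrite leqW.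
Qed.

(** The nodes and weights depend neither on [z] nor on [g], so the same approximants serve the real
    and imaginary parts of the kernels at [z] and at [x * z]. *)
Lemma transform_quotient_approx (R : realType) (sigma : R -> R) (x e : R) :
  (forall t : R, t \in `]0, 1[ -> derivable sigma t 1) ->
  (forall t : R, t \in `]0, 1[ -> 0 < sigma t) ->
  (\int[lebesgue_measure]_(t in `]0%R, 1%R[) (sigma t)%:E = 1)%E ->
  {in `]0, 1[ &, {homo (fun t : R => t * derive1 sigma t / sigma t) : s t /~ s <= t}} ->
  0 <= x <= 1 -> 0 < e ->
  exists (n : nat) (w t : nat -> R) (m : nat) (c p : nat -> R),
    [/\ forall j, 0 <= c j, \sum_(j < m.+1) c j = 1,
      forall j, (j <= m)%N -> 0 <= p j <= 1,
      forall i j, (i <= j <= m)%N -> p j <= p i &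
    (forall z : R[i], (forall s : R, 0 <= s <= 1 -> 1 - s%:C * z != 0) ->
    \sum_(i < n.+1) (w i)%:C / (1 - (t i)%:C * z) =
    (\sum_(i < n.+1) (w i)%:C / (1 - (t i)%:C * (x%:C * z))) *
      \sum_(j < m.+1) (c j)%:C / (1 - (p j)%:C * z)) /\
    forall (g : R -> R) (L : R),
      (forall s t, 0 <= s <= 1 -> 0 <= t <= 1 -> `|g s - g t| <= L * `|s - t|) ->
      (forall t, 0 <= t <= 1 -> `|g t| <= L) ->
      `|\int[@lebesgue_measure R]_(t in `]0, 1[) (g t * sigma t) -
        \sum_(i < n.+1) w i * g (t i)| <= L * e].
Proof.
move=> sd sp sint sdecr /andP[x0 x1] e0.
have [a [b [a0 ab b1 mass]]] := density_mass_interior sd sp sint (divr_gt0 e0 (ltr0n R 2)).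
(* [1 - q <= e / 4] gives [1 - q ^ 2 <= e / 2], the other half of [e] being the mass outside [[a,
   b[]; [1 - q <= 1 - b] gives [b <= q]. *)
have d0 : 0 < Num.min (e / 4) (1 - b).
  by rewrite lt_min subr_gt0 b1 andbT divr_gt0.
(* [x = 0] is not a power of [q] and is kept apart; [x = 1] is the power 0. In both cases [1 / 2]
   only serves to produce some [q] near 1. *)
have [q [k [q01 qk qd]]] : exists (q : R) (k : nat),
   [/\ 0 < q < 1, x = 0 \/ q ^+ k = x & 1 - Num.min (e / 4) (1 - b) <= q].
  have [x00|xpos] := leP x 0.
    have x_0 : x = 0 by apply/eqP; rewrite eq_le x00.
    have half : 0 < (2^-1 : R) < 1 by rewrite invr_gt0 ltr0n invf_lt1 ?ltr1n.
    by have [q [k [? _ ?]]] := root_near_one half d0; exists q, k; split=> //; left.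
  have [x11|xlt1] := leP 1 x.
    have x_1 : x = 1 by apply/eqP; rewrite eq_le x1.
    have half : 0 < (2^-1 : R) < 1 by rewrite invr_gt0 ltr0n invf_lt1 ?ltr1n.
    have [q [k [? _ ?]]] := root_near_one half d0; exists q, 0%N; split=> //; right.
    by rewrite expr0.
  have x01 : 0 < x < 1 by rewrite xpos.
  by have [q [k [? ? ?]]] := root_near_one x01 d0; exists q, k; split=> //; right.
have [n qn] := geometric_power_le q01 a0; have /andP[q0 q1] := q01.
have bq : b <= q.
  by apply: le_trans qd; rewrite lerBrDr -lerBrDl ge_min lexx orbT.
have qe : 1 - e / 4 <= q by apply: le_trans qd; rewrite lerD2l lerN2 ge_min lexx.
have estimate (g : R -> R) (L : R) :
      (forall s t, 0 <= s <= 1 -> 0 <= t <= 1 -> `|g s - g t| <= L * `|s - t|) ->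
      (forall t, 0 <= t <= 1 -> `|g t| <= L) ->
      `|\int[@lebesgue_measure R]_(t in `]0, 1[) (g t * sigma t) -
        \sum_(i < n.+1) geometric_weight sigma q i * g (q ^+ i)| <= L * e.
  move=> gL gb; have L0 : 0 <= L by apply: le_trans (gb 0 _); rewrite ?lexx ?ler01.
  apply: le_trans (geometric_sum_estimate sd sp sint gL gb q01 a0 ab bq qn) _.
  rewrite -mulrDr ler_wpM2l //.
  have : 1 - q ^+ 2 <= e / 2 by have := sqr_ge0 (1 - q); lra.
  by move: mass; lra.
have w0 i : 0 < geometric_weight sigma q i by exact: geometric_weight_gt0.
have wlc i := geometric_weight_log_concave sd sp i sdecr q01.
exists n, (geometric_weight sigma q), (fun i => q ^+ i).
case: qk => [x_0|qk]; last first.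
  have [m [c [p [h1 h2 h3 h4 h5]]]] := geometric_transform_quotient n k q01 w0 wlc.
  by exists m, c, p; split=> //; split=> // z /h5; rewrite qk.
(* For [x = 0] the dilated sum is the constant [W], so the quotient is already a convex combination,
   with masses [w i / W] at the nodes. *)
pose W := \sum_(i < n.+1) geometric_weight sigma q i.
have W0 : 0 < W.
  rewrite /W big_ord_recl ltr_wpDr //; apply: sumr_ge0 => i _; exact: ltW.
exists n, (fun i => geometric_weight sigma q i / W), (fun i => q ^+ i); split.
- by move=> j; rewrite divr_ge0 ?ltW.
- by rewrite -mulr_suml divff // gt_eqF.
- by move=> j _; rewrite exprn_ge0 ?exprn_ile1 ?(ltW q0) ?(ltW q1).
- by move=> i j /andP[ij _]; rewrite ler_wiXn2l ?(ltW q0) ?(ltW q1).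
split=> // z znz; rewrite x_0 mul0r.
under [X in _ = X * _]eq_bigr => i _ do rewrite mulr0 subr0 divr1.
rewrite -rmorph_sum /= mulr_sumr; apply: eq_bigr => i _.
rewrite mulrA -rmorphM /=; congr (_%:C / _).
by rewrite mulrC divfK // gt_eqF.
Qed.

(** * Nonvanishing of the transform and passage to the limit *)

Lemma complex_sum_ReIm (R : rcfType) (n : nat) (a : nat -> R) (k : nat -> R[i]) :
  \sum_(i < n) (a i)%:C * k i =
  (\sum_(i < n) a i * complex.Re (k i)) +i* (\sum_(i < n) a i * complex.Im (k i)).
Proof.
elim: n => [|n IH]; first by rewrite !big_ord0.
rewrite !big_ord_recr /= IH; case: (k n) => u v /=.
by rewrite /real_complex_def; simpc.
Qed.

Lemma cvg_ultra_harmonic (R : realType) (U : set_system nat) (u : nat -> R) (l L : R) :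
  \oo `<=` U -> (forall N, `|l - u N| <= L * N.+1%:R^-1) -> u N @[N --> U] --> l.
Proof.
move=> ooU ul; suff ucvg : u N @[N --> \oo] --> l by move=> V /ucvg; exact: ooU.
have Lcvg : L * N.+1%:R^-1 @[N --> \oo] --> L * 0.
  by apply: cvgMl_tmp; exact: cvg_harmonic.
rewrite mulr0 in Lcvg; apply/cvgrPdist_lt => e e0.
move/cvgr_dist_lt : Lcvg => /(_ e e0); apply: filterS => N.
rewrite sub0r normrN => H; apply: le_lt_trans (ul N) _.
exact: le_lt_trans (ler_norm _) H.
Qed.

Lemma slit_planeP (R : realType) (z : R[i]) :
  slit_plane z -> complex.Im z = 0 -> complex.Re z < 1.
Proof.
move=> zs zi; rewrite ltNge; apply/negP => zr; apply: zs.
by exists (complex.Re z) => /=; [rewrite in_itv /= zr|case: z zi zr => a b /= ->].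
Qed.

Section transform.
Variables (R : realType) (sigma : R -> R).
Hypothesis sd : forall t : R, t \in `]0, 1[ -> derivable sigma t 1.
Hypothesis sp : forall t : R, t \in `]0, 1[ -> 0 < sigma t.
Hypothesis sint1 : (\int[lebesgue_measure]_(t in `]0%R, 1%R[) (sigma t)%:E = 1)%E.
Local Notation mu := (@lebesgue_measure R).

Lemma density_transformE (z : R[i]) : density_transform sigma z =
  (\int[mu]_(t in `]0, 1[) (complex.Re (1 - t%:C * z)^-1 * sigma t)) +i*
  (\int[mu]_(t in `]0, 1[) (complex.Im (1 - t%:C * z)^-1 * sigma t)).
Proof.
rewrite /density_transform /cintegral; congr (_ +i* _); apply: eq_Rintegral => t _;
  case: ((1 - t%:C * z)^-1) => u v; rewrite /real_complex_def; simpc;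
  by rewrite /= mulrC.
Qed.

(** The kernel takes its values in the half plane [Re + beta * Im >= c], which is convex and avoids
    0; hence so does its average against the probability density [sigma]. *)
Lemma density_transform_neq0 (z : R[i]) :
  (complex.Im z = 0 -> complex.Re z < 1) -> density_transform sigma z != 0.
Proof.
move=> /kernel_bounds[L [beta [c [L0 c0 _ kc [Rb Ib Rl Il]]]]].
rewrite density_transformE eq_complex /=; apply/negP => /andP[/eqP r0 /eqP i0].
have si := density_integrable sd sp sint1.
have ri := density_integrable_mul sd sp sint1 Rl Rb.
have ii := density_integrable_mul sd sp sint1 Il Ib.
have bii : mu.-integrable `]0, 1[ (EFin \o (fun t =>
    beta * (complex.Im (1 - t%:C * z)^-1 * sigma t))) by exact: integrableZl ii.
have : c * \int[mu]_(t in `]0, 1[) sigma t <=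
   \int[mu]_(t in `]0, 1[) (complex.Re (1 - t%:C * z)^-1 * sigma t +
      beta * (complex.Im (1 - t%:C * z)^-1 * sigma t)).
  rewrite -RintegralZl //; apply: le_Rintegral => //.
  - exact: (integrableZl _ c si).
  - by apply: integrableD ri bii.
  move=> t; rewrite /= => t01; have s0 := sp t01.
  rewrite mulrA -mulrDl ler_pM2r //; apply: kc.
  by move: t01; rewrite in_itv /= => /andP[/ltW -> /ltW ->].
rewrite RintegralD // RintegralZl // r0 i0 mulr0 addr0 density_mass // mulr1.
by rewrite leNgt c0.
Qed.

End transform.

Unset Implicit Arguments.

Theorem theorem1p6 (R : realType) (sigma : R -> R)
  (sigma_derivable : forall t : R, t \in `]0, 1[ -> derivable sigma t 1)
  (sigma_C1 : {within `]0, 1[%classic, continuous derive1 sigma})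
  (sigma_pos : forall t : R, t \in `]0, 1[ -> 0 < sigma t)
  (sigma_int : (\int[lebesgue_measure]_(t in `]0%R, 1%R[) (sigma t)%:E = 1)%E)
  (sigma_decr : {in `]0, 1[ &,
     {homo (fun t : R => t * derive1 sigma t / sigma t) : s t /~ s <= t}})
  (x : R) (x01 : x \in `[0, 1]) :
  classT (fun z : R[i] =>
    density_transform sigma z / density_transform sigma (x%:C * z)).
Proof.
have {}x01 : 0 <= x <= 1 by move: x01; rewrite in_itv.
have /andP[x0 x1] := x01.
have eN N : (0 : R) < N.+1%:R^-1 by rewrite invr_gt0 ltr0n.
have /choice[n /choice[w /choice[t /choice[m /choice[c /choice[p approx]]]]]] N :=
  transform_quotient_approx sigma_derivable sigma_pos sigma_int sigma_decr x01 (eN N).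
(* [U] refines [\oo], so the error estimates still tend to 0 along it; since it is chosen before
   [z], the law [nu] does not depend on [z]. *)
have [U [UU ooU]] := @ultraFilterLemma nat \oo _.
have [||||nu [nu1 nucvg]] := @atomic_laws_ultralimit R U m c p UU.
- by move=> N; have [] := approx N.
- by move=> N; have [] := approx N.
- by move=> N; have [] := approx N.
- by move=> N; have [] := approx N.
exists nu; split=> // z /slit_planeP zs.
have xzE : x%:C * z = (x * complex.Re z) +i* (x * complex.Im z).
  by case: z {zs} => a b; rewrite /real_complex_def; simpc.
have xzs : complex.Im (x%:C * z) = 0 -> complex.Re (x%:C * z) < 1.
  rewrite xzE /= => /eqP; rewrite mulf_eq0 => /orP[/eqP ->|/eqP /zs zr].
    by rewrite mul0r.
  have [z0|z0] := leP (complex.Re z) 0; first by rewrite (le_lt_trans _ ltr01) // mulr_ge0_le0.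
  by rewrite (le_lt_trans _ zr) // ler_piMl // ltW.
have fnz := density_transform_neq0 sigma_derivable sigma_pos sigma_int xzs.
apply: (canLR (mulfK fnz)).
have [L [_ [_ [_ _ znz _ [Rb Ib Rl Il]]]]] := kernel_bounds zs.
have [L' [_ [_ [_ _ _ _ [Rb' Ib' Rl' Il']]]]] := kernel_bounds xzs.
have est g l (gl : forall s t, 0 <= s <= 1 -> 0 <= t <= 1 -> `|g s - g t| <= l * `|s - t|)
   (gb : forall t, 0 <= t <= 1 -> `|g t| <= l) :
   \sum_(i < (n N).+1) w N i * g (t N i) @[N --> U] -->
   \int[lebesgue_measure]_(t in `]0, 1[) (g t * sigma t).
  apply: (cvg_ultra_harmonic (L := l)) => // N.
  by have [_ _ _ _ [_ +]] := approx N; apply.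
have cR := est _ _ Rl Rb; have cI := est _ _ Il Ib.
have cR' := est _ _ Rl' Rb'; have cI' := est _ _ Il' Ib'.
have cr := nucvg _ _ Rl; have ci := nucvg _ _ Il.
rewrite !density_transformE /cintegral; simpc.
have E N : \sum_(i < (n N).+1) (w N i)%:C / (1 - (t N i)%:C * z) =
    (\sum_(j < (m N).+1) (c N j)%:C / (1 - (p N j)%:C * z)) *
    (\sum_(i < (n N).+1) (w N i)%:C / (1 - (t N i)%:C * (x%:C * z))).
  by rewrite [RHS]mulrC; have [_ _ _ _ [+ _]] := approx N; apply.
have UP : ProperFilter U := @ultra_proper _ U UU.
have {}E N := etrans (esym (complex_sum_ReIm _ (w N) (fun i => (1 - (t N i)%:C * z)^-1)))
  (E N).
have {}E N := etrans (E N) (congr2 *%R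
  (complex_sum_ReIm _ (c N) (fun i => (1 - (p N i)%:C * z)^-1))
  (complex_sum_ReIm _ (w N) (fun i => (1 - (t N i)%:C * (x%:C * z))^-1))).
(* Both sides of [E] converge along [U], and uniqueness of limits gives the identity separately for
   the real and the imaginary part. *)
congr (_ +i* _).
- refine (@cvg_unique _ (@Rhausdorff R) _ (fmap_proper_filter _ UP) _ _ cR _).
  apply: cvg_trans (_ : _ --> _); last exact: (cvgB (cvgM cr cR') (cvgM ci cI')).
  apply: near_eq_cvg; apply: filterE => N.
  by have := E N; simpc; case=> -> _.
- refine (@cvg_unique _ (@Rhausdorff R) _ (fmap_proper_filter _ UP) _ _ cI _).
  apply: cvg_trans (_ : _ --> _); last exact: (cvgD (cvgM cr cI') (cvgM ci cR')).
  apply: near_eq_cvg; apply: filterE => N.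
  by have := E N; simpc; case=> _ ->.
Qed.
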